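(* Let $A$ be an alternative Cartan $*$-algebra with $\mathbb{S}_A\ne\varnothing$, let $\Omega\subset Q_A$ be a circular slice domain, let $f:\Omega\to A$ be a slice regular function with real components $f_K$ ($K\in\mathcal{P}(n)$), and let $\mathcal{C}$ be a system of Cartan pairs (SCP) of $A$. Suppose that, for each $L,M\in\mathcal{P}(n)$ with $(e_L,e_M)\in\mathcal{C}$, there exists a point $x_{L,M}\in\Omega\cap\mathbb{C}_{e_{L\triangle M}}$ such that the module $|f_L|$ of $f_L$ has a local maximum at $x_{L,M}$. Then $f$ is constant on $\Omega$.
   Context: **Cartan $*$-algebras.** Let $n\ge 1$, let $\mathcal{P}(n)$ be the power set of $\{1,\dots,n\}$ and $K\triangle H:=(K\setminus H)\cup(H\setminus K)$. A Cartan algebra is a real (not necessarily associative) algebra $A$ with a fixed real vector basis $\{e_K\}_{K\in\mathcal{P}(n)}$ and a function $\sigma:\mathcal{P}(n)\times\mathcal{P}(n)\to\{-1,1\}$ such that $\sigma(K,\varnothing)=\sigma(\varnothing,K)=1$ and $e_Ke_H=\sigma(K,H)e_{K\triangle H}$ for all $K,H$. Thus $e_\varnothing=1$ is the unity, and $\mathbb{R}$ is identified with $\mathbb{R}1\subset A$. $A$ is alternative if $x(xy)=x^2y$ and $(xy)y=xy^2$ for all $x,y$. A $*$-involution is a real linear map $x\mapsto x^c$ with $(x^c)^c=x$, $(xy)^c=y^cx^c$ and $x^c=x$ for $x\in\mathbb{R}$. A Cartan $*$-algebra is a Cartan algebra endowed with a $*$-involution such that $e_{\{k\}}^c\in\{e_{\{k\}},-e_{\{k\}}\}$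 for $k=1,\dots,n$. Set $\mathbb{S}_A:=\{J\in A: J^c=-J,\ J^2=-1\}$. The paper assumes throughout that $A$ is alternative and $\mathbb{S}_A\neq\varnothing$. $A$ has the usual topology of a finite dimensional real vector space and $\Omega$ the induced one. **Systems of Cartan pairs.** For $L,M\in\mathcal{P}(n)$, $(e_L,e_M)$ is a Cartan pair if $e_Le_M\in\mathbb{S}_A$ (equivalently $e_{L\triangle M}\in\mathbb{S}_A$). For a set $\mathcal{C}$ of pairs $(e_L,e_M)$, put $\mathcal{C}_1:=\{L:\exists M,\ (e_L,e_M)\in\mathcal{C}\}$ and $\mathcal{C}_2:=\{M:\exists L,\ (e_L,e_M)\in\mathcal{C}\}$. $\mathcal{C}$ is a system of Cartan pairs (SCP) of $A$ if all its elements are Cartan pairs, $\mathcal{C}_1\cup\mathcal{C}_2=\mathcal{P}(n)$ and $\mathcal{C}_1\cap\mathcal{C}_2=\varnothing$. **Slice regular functions.** For $J\in\mathbb{S}_A$ let $\mathbb{C}_J:=\{\alpha+\beta J:\alpha,\beta\in\mathbb{R}\}$, and let $Q_A:=\bigcup_{J\in\mathbb{S}_A}\mathbb{C}_J$. For $D\subset\mathbb{C}$ non-empty, open and invariant under complex conjugation, let $\Omega_D:=\{\alpha+\beta J:\alpha,\beta\in\mathbb{R},\ \alpha+i\beta\in D,\ J\in\mathbb{S}_A\}\subset Q_A$ (an open circular set). It is a circular slice domain if moreover $D$ is connected and $D\cap\mathbb{R}\ne\varnothing$. A stem function on $D$ is $F=F_1+\iota F_2:D\to A\otimes_{\mathbb{R}}\mathbb{C}$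 ($\iota$ the imaginary unit of the second factor, $F_1,F_2:D\to A$) with $F_1(\bar z)=F_1(z)$, $F_2(\bar z)=-F_2(z)$. It induces the slice function $f=\mathcal{I}(F):\Omega_D\to A$, $f(\alpha+\beta J)=F_1(\alpha+i\beta)+JF_2(\alpha+i\beta)$. $f$ is slice regular if $F$ is of class $C^1$ and $\frac{\partial F}{\partial\alpha}+\iota\frac{\partial F}{\partial\beta}=0$. The real components of $f$ are the functions $f_K:\Omega_D\to\mathbb{R}$ with $f=\sum_K f_Ke_K$. *)

(* Defs.v *)
From HB Require Import structures.
From mathcomp Require Import all_boot all_order all_algebra.
From mathcomp Require Import all_classical all_reals all_analysis.

Set Implicit Arguments.
Unset Strict Implicit.
Unset Printing Implicit Defensive.

Import Order.TTheory GRing.Theory Num.Theory.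
Import numFieldNormedType.Exports.

Local Open Scope classical_set_scope.
Local Open Scope ring_scope.

Definition symdiff (T : finType) (K H : {set T}) : {set T} :=
  (K :\: H) :|: (H :\: K).

(* The multiplication is not assumed associative, so it is kept as a bare
   bilinear map on a finite dimensional vector space. *)
Record cartanAlgebra (R : realType) (n : nat) := CartanAlgebra {
  carrier :> vectType R;
  cmul : carrier -> carrier -> carrier;
  cbas : {set 'I_n} -> carrier;
  csgn : {set 'I_n} -> {set 'I_n} -> R;
  cmul_linearl : forall y, linear (cmul^~ y);
  cmul_linearr : forall x, linear (cmul x);
  cbas_basis : basis_of fullv (codom_tuple cbas);
  csgn_pm1 : forall K H, csgn K H = 1 \/ csgn K H = -1;
  csgnr0 : forall K, csgn K finset.set0 = 1;
  csgn0r : forall K, csgn finset.set0 K = 1;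
  cmul_bas : forall K H,
    cmul (cbas K) (cbas H) = csgn K H *: cbas (symdiff K H) }.

Definition cunit (R : realType) (n : nat) (A : cartanAlgebra R n) : A :=
  cbas A finset.set0.

Definition ccoord (R : realType) (n : nat) (A : cartanAlgebra R n)
    (K : {set 'I_n}) (x : A) : R :=
  coord (codom_tuple (cbas A)) (enum_rank K) x.

Definition alternative (R : realType) (n : nat) (A : cartanAlgebra R n) :=
  forall x y : A, cmul x (cmul x y) = cmul (cmul x x) y /\
                  cmul (cmul x y) y = cmul x (cmul y y).

Record cartanStarAlgebra (R : realType) (n : nat) := CartanStarAlgebra {
  cartan :> cartanAlgebra R n;
  cconj : cartan -> cartan;
  cconj_linear : linear cconj;
  cconjK : involutive cconj;
  cconjM : forall x y, cconj (cmul x y) = cmul (cconj y) (cconj x);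
  cconj_real : forall a : R, cconj (a *: cunit cartan) = a *: cunit cartan;
  cconj_gen : forall k : 'I_n,
    cconj (cbas cartan [set k]%SET) = cbas cartan [set k]%SET \/
    cconj (cbas cartan [set k]%SET) = - cbas cartan [set k]%SET }.

Section CartanStar.
Context {R : realType} {n : nat} (A : cartanStarAlgebra R n).

Definition imag_units : set A :=
  [set J : A | cconj J = - J /\ cmul J J = - cunit A].

Definition cartan_pair (L M : {set 'I_n}) : Prop :=
  imag_units (cmul (cbas A L) (cbas A M)).

Definition fst_indices (C : set (A * A)) : set {set 'I_n} :=
  [set L | exists M, C (cbas A L, cbas A M)].

Definition snd_indices (C : set (A * A)) : set {set 'I_n} :=
  [set M | exists L, C (cbas A L, cbas A M)].

Definition SCP (C : set (A * A)) : Prop :=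
  [/\ forall p, C p ->
        exists L M, p = (cbas A L, cbas A M) /\ cartan_pair L M,
      fst_indices C `|` snd_indices C = setT &
      fst_indices C `&` snd_indices C = set0].

Definition slice_point (J : A) (a b : R) : A := a *: cunit A + b *: J.

Definition slice_plane (J : A) : set A :=
  [set x | exists a b : R, x = slice_point J a b].

(* The complex plane is R * R with its product topology; only its topology,
   its conjugation and its two real directions are involved. *)
Definition zbar (z : R * R) : R * R := (z.1, - z.2).

Definition slice_domain (D : set (R * R)) : Prop :=
  [/\ D !=set0, open D, (forall z, D z -> D (zbar z)), connected D &
      exists a : R, D (a, 0)].

Definition circular_set (D : set (R * R)) : set A :=
  [set x | exists a b J, [/\ D (a, b), imag_units J & x = slice_point J a b]].

(* A (x) C is A * A, the pair (x, y) standing for x + iota y. *)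
Definition iota_mul (w : A * A) : A * A := (- w.2, w.1).

Definition stem_function (D : set (R * R)) (F : R * R -> A * A) : Prop :=
  forall z, D z -> (F (zbar z)).1 = (F z).1 /\ (F (zbar z)).2 = - (F z).2.

Definition induces (D : set (R * R)) (F : R * R -> A * A) (f : A -> A) : Prop :=
  forall a b J, D (a, b) -> imag_units J ->
    f (slice_point J a b) = (F (a, b)).1 + cmul J (F (a, b)).2.

End CartanStar.

Arguments imag_units {R n} A.
Arguments circular_set {R n} A D.

(* The usual topology of a finite dimensional real vector space V is the one
   for which the coordinate isomorphism V -> 'rV[R]_(\dim {:V}) of some (any)
   basis is a homeomorphism; derivatives are likewise computed in these
   coordinates. *)
Section FiniteDim.
Context {R : realType} {V : vectType R}.

Definition to_rV : V -> 'rV[R]_(\dim {:V}) := passmx.rVof (vbasis {:V}).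
Definition of_rV : 'rV[R]_(\dim {:V}) -> V := passmx.vecof (vbasis {:V}).

Definition local_max_on (W : set V) (g : V -> R) (x : V) : Prop :=
  \forall y \near (x : initial_topology to_rV), W y -> g y <= g x.

Definition partial (v : R * R) (F : R * R -> V) (z : R * R) : V :=
  of_rV ('D_v (to_rV \o F) z).

Definition C1_on (D : set (R * R)) (F : R * R -> V) : Prop :=
  forall v, v = (1, 0) \/ v = (0, 1) -> forall z, D z ->
    derivable (to_rV \o F) z v /\ {for z, continuous (to_rV \o partial v F)}.

End FiniteDim.

(* f stands for a function on circular_set A D: its values elsewhere are
   unconstrained. *)
Definition slice_regular {R : realType} {n : nat} (A : cartanStarAlgebra R n)
    (D : set (R * R)) (f : A -> A) : Prop :=
  exists F : R * R -> A * A,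
    [/\ stem_function D F, induces D F f, C1_on D F &
        forall z, D z ->
          partial (1, 0) F z + iota_mul (partial (0, 1) F z) = 0].

(* Main.v *)
Require Import Defs.
From mathcomp Require Import all_boot all_order all_algebra.
From mathcomp Require Import all_classical all_reals all_analysis.
From mathcomp Require Import ring lra.
Import Order.TTheory GRing.Theory Num.Theory.
Import numFieldNormedType.Exports.
Local Open Scope classical_set_scope.
Local Open Scope ring_scope.

(** Let [F = F1 + iota F2] be the holomorphic stem function of [f], let [(e_L, e_M)]
    be a pair of the system, and let [J] be the basis unit indexed by the symmetric
    difference of [L] and [M]. On the slice of [J] the component [f_L] is the real
    function [l \o F], where [l w] is the [L]-th coordinate of [w.1 + J w.2], and it is
    the real part of the holomorphic function [l \o F - i l (iota F)] on [D]. Since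
    the modulus of this real part has a local maximum, the holomorphic function is
    constant on the connected set [D] ([abs_max_constant]). Left multiplication by
    [J] exchanges, up to sign, the coordinates [L] and [M] ([ccoord_mul]); so the real
    and imaginary parts of the constant combine the coordinates [L] of [F1] and [M] of
    [F2], respectively [L] of [F2] and [M] of [F1]. As [F1] is even and [F2] is odd under
    conjugation, comparing the values at [z] and at its conjugate shows that the
    coordinates [L] and [M] of [F1] are constant and those of [F2] vanish. Every index
    occurs as some [L] or some [M], hence [F1] is constant, [F2 = 0] and [f] is constant.

    The function theory is developed for pairs of real functions on the plane that
    have continuous partial derivatives and satisfy the Cauchy-Riemann equations. It
    has a single analytic input, [no_local_max]: a real part plus a positive multiple
    of [(z.1 - c) ^ 2] has no local maximum. This is the second derivative test, once
    averaging over short segments has provided second derivatives. A Schwarz lemma for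
    double zeros ([schwarz]) follows, by applying the resulting maximum principle to
    the quotient by [z - p]. It yields both facts that are needed:
    - the strong maximum principle, by applying it to [h / (h - 2 e)] and letting [e]
      tend to 0, where [h] vanishes at the maximum point and [Re h <= 0];
    - unique continuation, by dividing a function that vanishes near [p] by [z - p]
      over and over: on a box around [p] it is at most a constant times
      [(|z - p| / r) ^ N] for every [N]. *)

(** * Boxes, partial derivatives and extrema *)

Section Planar.
Context {R : realType}.
Implicit Types (u v a b f : R * R -> R) (z w p : R * R) (O : set (R * R)).

(** Through this lemma and the next one, the one-variable mean value theorem,
    extremum tests and fundamental theorem of calculus apply to derivatives along
    the axes. *)
Lemma is_derive_slice1 f z l :
  is_derive z (1, 0) f l <-> is_derive z.1 1 (fun x => f (x, z.2)) l.
Proof.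
have E : (fun h : R => h^-1 *: ((f \o shift z) (h *: (1, 0)) - f z)) =
  (fun h : R => h^-1 *: (((fun x => f (x, z.2)) \o shift z.1) (h *: 1) - f (z.1, z.2))).
  apply/funext => h /=; rewrite -surjective_pairing; congr (_ *: (f _ - _)).
  by case: z => x y /=; congr (_, _) => /=; rewrite scaler0 add0r.
split=> -[d1 d2]; split.
- by move: d1; rewrite /derivable E.
- by move: d2; rewrite /derive E.
- by move: d1; rewrite /derivable E.
- by move: d2; rewrite /derive E.
Qed.

Lemma is_derive_slice2 f z l :
  is_derive z (0, 1) f l <-> is_derive z.2 1 (fun y => f (z.1, y)) l.
Proof.
have E : (fun h : R => h^-1 *: ((f \o shift z) (h *: (0, 1)) - f z)) =
  (fun h : R => h^-1 *: (((fun y => f (z.1, y)) \o shift z.2) (h *: 1) - f (z.1, z.2))).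
  apply/funext => h /=; rewrite -surjective_pairing; congr (_ *: (f _ - _)).
  by case: z => x y /=; congr (_, _) => /=; rewrite scaler0 add0r.
split=> -[d1 d2]; split.
- by move: d1; rewrite /derivable E.
- by move: d2; rewrite /derive E.
- by move: d1; rewrite /derivable E.
- by move: d2; rewrite /derive E.
Qed.

(** Balls of the product norm, written out so that linear arithmetic sees
    their inequalities. *)
Definition box p (r : R) : set (R * R) :=
  [set z | `|z.1 - p.1| < r /\ `|z.2 - p.2| < r].
Definition cbox p (r : R) : set (R * R) :=
  [set z | `|z.1 - p.1| <= r /\ `|z.2 - p.2| <= r].

Lemma box_ball p r : box p r = ball p r.
Proof.
apply/seteqP; split=> z.
  by move=> [h1 h2]; split; rewrite /ball /= distrC.
by move=> [+ +]; rewrite /ball /= !(distrC p.1) !(distrC p.2) => h1 h2; split.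
Qed.

Lemma nbhs_boxP p (P : set (R * R)) :
  nbhs p P <-> exists2 r, 0 < r & box p r `<=` P.
Proof.
split=> [/nbhs_ballP[r r0 h]|[r r0 h]].
  by exists r => //; rewrite box_ball.
by apply/nbhs_ballP; exists r => //; rewrite -box_ball.
Qed.

Lemma box_cbox p (r s : R) : s < r -> cbox p s `<=` box p r.
Proof. by move=> sr z [h1 h2]; split; exact: le_lt_trans sr. Qed.

Lemma cbox_box p (r : R) : box p r `<=` cbox p r.
Proof. by move=> z [h1 h2]; split; exact: ltW. Qed.

Lemma compact_cbox p (r : R) : compact (cbox p r).
Proof.
have -> : cbox p r = `[p.1 - r, p.1 + r]%classic `*` `[p.2 - r, p.2 + r]%classic.
  by apply/seteqP; split=> z []; rewrite /= !in_itv /= -!ler_distl => h1 h2; split.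
by apply: compact_setX; exact: segment_compact.
Qed.

Lemma derive1_lipschitz (g dg : R -> R) (x0 r C : R) :
  (forall x, `|x - x0| < r -> is_derive x 1 g (dg x)) ->
  (forall x, `|x - x0| < r -> `|dg x| <= C) ->
  forall x y, `|x - x0| < r -> `|y - x0| < r -> `|g x - g y| <= C * `|x - y|.
Proof.
move=> hd hb.
suff H x y : x <= y -> `|x - x0| < r -> `|y - x0| < r -> `|g x - g y| <= C * `|x - y|.
  move=> x y hx hy; have [xy|/ltW yx] := leP x y; first exact: H.
  by rewrite distrC (distrC x); exact: H.
move=> xy; rewrite !ltr_distl => /andP[h1 h2] /andP[h3 h4].
have inr t : x <= t -> t <= y -> `|t - x0| < r.
  by move=> xt ty; rewrite ltr_distl; lra.
have dx t : t \in `]x, y[ -> is_derive t 1 g (dg t).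
  by rewrite in_itv /= => /andP[/ltW ? /ltW ?]; apply: hd; exact: inr.
have [|c] := MVT_segment xy dx.
  apply: derivable_within_continuous => t; rewrite in_itv /= => /andP[? ?].
  by have [] := hd t (inr _ _ _).
rewrite in_itv /= => /andP[? ?] e.
rewrite distrC e normrM (distrC x); apply: ler_wpM2r => //.
by apply: hb; exact: inr.
Qed.

(** Move first along one axis, then along the other; the corner of the path
    stays in the box, which is why squares are used instead of discs. *)
Lemma partials_lipschitz f (fx fy : R * R -> R) p (r C : R) :
  (forall z, box p r z -> is_derive z (1, 0) f (fx z)) ->
  (forall z, box p r z -> is_derive z (0, 1) f (fy z)) ->
  (forall z, box p r z -> `|fx z| <= C) ->
  (forall z, box p r z -> `|fy z| <= C) ->
  forall z w, box p r z -> box p r w ->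
    `|f z - f w| <= C * (`|z.1 - w.1| + `|z.2 - w.2|).
Proof.
move=> dx dy bx by_ [x y] [x' y'] [/= hx hy] [/= hx' hy'].
rewrite -(subrKA (f (x', y))) (le_trans (ler_normD _ _))// mulrDr lerD//.
- apply: (@derive1_lipschitz (fun x => f (x, y)) (fun x => fx (x, y)) p.1 r) => // t ht.
    by apply: (is_derive_slice1 _ (t, y) _).1; apply: dx.
  exact: bx.
- apply: (@derive1_lipschitz (fun y => f (x', y)) (fun y => fy (x', y)) p.2 r) => // t ht.
    by apply: (is_derive_slice2 _ (x', t) _).1; apply: dy.
  exact: by_.
Qed.

Lemma continuous_bounded_near f p : {for p, continuous f} ->
  \forall z \near p, `|f z| <= `|f p| + 1.
Proof.
move=> /cvgrPdist_le /(_ 1 ltr01); apply: filterS => z h.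
rewrite -lerBlDl (le_trans _ h)// distrC; apply: le_trans (lerB_dist _ _) _.
by [].
Qed.

Lemma partials_continuous f (fx fy : R * R -> R) p :
  (\forall z \near p, is_derive (z : R * R) (1, 0) f (fx z) /\
                    is_derive (z : R * R) (0, 1) f (fy z)) ->
  {for p, continuous fx} -> {for p, continuous fy} -> {for p, continuous f}.
Proof.
move=> hd cx cy.
have /nbhs_boxP[r r0 hr] : \forall z \near p,
  [/\ is_derive (z : R * R) (1, 0) f (fx z), is_derive (z : R * R) (0, 1) f (fy z),
   `|fx z| <= `|fx p| + 1 & `|fy z| <= `|fy p| + 1].
  have := continuous_bounded_near _ _ cx; have := continuous_bounded_near _ _ cy.
  by apply: filterS3 hd => z [? ?] ? ?.
set C := (`|fx p| + 1) + (`|fy p| + 1).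
have C0 : 0 < C by rewrite /C; have := normr_ge0 (fx p); have := normr_ge0 (fy p); lra.
have p0 : box p r p by rewrite /box /= !subrr normr0.
have L := @partials_lipschitz f fx fy p r C.
apply/cvgrPdist_le => e e0; apply/nbhs_boxP.
exists (Num.min r (e / (2 * C))); first by rewrite lt_min r0 divr_gt0// mulr_gt0.
move=> z [/=]; rewrite !lt_min => /andP[h1 h2] /andP[h3 h4].
apply: le_trans (L _ _ _ _ p z p0 _) _ => //.
- by move=> w /hr[].
- by move=> w /hr[].
- by move=> w /hr[_ _ + _]; rewrite /C; have := normr_ge0 (fy p); lra.
- by move=> w /hr[_ _ _]; rewrite /C; have := normr_ge0 (fx p); lra.
- rewrite (distrC p.1) (distrC p.2).
  rewrite mulrC -ler_pdivlMr//.
  have : e / (2 * C) = (e / C) / 2 by field; rewrite gt_eqF.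
  by move: h2 h4; set q := e / (2 * C); set q' := e / C => *; lra.
Qed.

Lemma derive_local_max (g dg : R -> R) (x0 : R) :
  (\forall x \near x0, is_derive (x : R) 1 g (dg x)) ->
  (\forall x \near x0, g x <= g x0) -> dg x0 = 0.
Proof.
move=> hd hm.
have /nbhs_ballP[r /= r0 hr] : \forall x \near x0, is_derive (x : R) 1 g (dg x) /\ g x <= g x0.
  by near=> x; split; near: x.
have inb t : `|t - x0| < r -> ball x0 r t by rewrite /ball /= distrC.
have [_ <-] := nbhs_singleton hd.
have i0 : x0 \in `]x0 - r, x0 + r[ by rewrite in_itv /=; lra.
have [|t|t|] // := @derive1_at_max _ g (x0 - r) (x0 + r) x0 _ _ i0 _.
- by lra.
- rewrite in_itv /= => /andP[? ?]; have [|[]] // := hr t.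
  by apply: inb; rewrite ltr_distl; lra.
- rewrite in_itv /= => /andP[? ?]; have [|] // := hr t.
  by apply: inb; rewrite ltr_distl; lra.
Unshelve. all: by end_near. Qed.

(** If the second derivative were positive, the first one, which vanishes at
    the maximum, would be positive just to the right of it. *)
Lemma second_derivative_test (g dg : R -> R) (x0 k : R) :
  (\forall x \near x0, is_derive (x : R) 1 g (dg x)) -> is_derive x0 1 dg k ->
  (\forall x \near x0, g x <= g x0) -> k <= 0.
Proof.
move=> hd hk hm.
have dg0 := derive_local_max g dg x0 hd hm.
have /nbhs_ballP[r /= r0 hr] : \forall x \near x0, is_derive (x : R) 1 g (dg x) /\ g x <= g x0.
  by near=> x; split; near: x.
have inb t : `|t - x0| < r -> ball x0 r t by rewrite /ball /= distrC.
rewrite leNgt; apply/negP => k0.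
(* the slopes of dg at x0 tend to k > 0, so dg > 0 on some interval to the right *)
have [/cvg_ex[/= l hl] hk2] := hk.
have lk : l = k by rewrite -hk2; apply/esym/cvg_lim.
rewrite {}lk in hl.
have /nbhs_ballP[s /= s0 hs] : \forall h \near 0^', 0 < h^-1 *: (dg (h *: 1 + x0) - dg x0).
  exact: (cvgr_gt _ hl).
pose m := Num.min (r / 2) (s / 2).
have m0 : 0 < m by rewrite lt_min; apply/andP; split; lra.
have [mr ms] : m <= r / 2 /\ m <= s / 2.
  by split; rewrite ge_min lexx ?orbT.
have dpos t : 0 < t -> t <= m -> 0 < dg (t + x0).
  move=> t0 tm; have := hs t; rewrite /ball /= sub0r normrN gtr0_norm//.
  move=> /(_ _ _); rewrite dg0 subr0 pmulr_rgt0 ?invr_gt0// [t%:A]mulr1; apply.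
    by lra.
  by rewrite gt_eqF.
have [|||c] := @MVT _ g dg x0 (x0 + m).
- by lra.
- move=> x; rewrite in_itv /= => /andP[? ?]; have [|] // := hr x.
  by apply: inb; rewrite ltr_distl; lra.
- apply: derivable_within_continuous => x; rewrite in_itv /= => /andP[? ?].
  by have [|[]] := hr x => //; apply: inb; rewrite ltr_distl; lra.
rewrite in_itv /= => /andP[c1 c2] e.
have : 0 < g (x0 + m) - g x0.
  rewrite e addrAC subrr add0r mulr_gt0//.
  have -> : c = (c - x0) + x0 by ring.
  by apply: dpos; lra.
have [|_] := hr (x0 + m); first by apply: inb; rewrite ltr_distl; lra.
by lra.
Unshelve. all: by end_near. Qed.

End Planar.

(** * Holomorphic functions as pairs of real functions *)

Section Holo.
Context {R : realType}.
Implicit Types (u v a b f : R * R -> R) (z w p : R * R) (O : set (R * R)).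

(** [u + i v] is holomorphic on [O] with continuous derivative [a + i b]. The
    derivative is a parameter of the predicate because products and quotients
    of such functions are formed below with their derivatives. *)
Record holomorphic O u v a b : Prop := Holo {
  holo_ux : forall z, O z -> is_derive z (1, 0) u (a z);
  holo_uy : forall z, O z -> is_derive z (0, 1) u (- b z);
  holo_vx : forall z, O z -> is_derive z (1, 0) v (b z);
  holo_vy : forall z, O z -> is_derive z (0, 1) v (a z);
  holo_ca : forall z, O z -> {for z, continuous a};
  holo_cb : forall z, O z -> {for z, continuous b} }.

Lemma holo_sub O O' u v a b : O' `<=` O -> holomorphic O u v a b -> holomorphic O' u v a b.
Proof. by move=> s [*]; split=> z /s; auto. Qed.

Lemma holo_continuous O u v a b z : open O -> holomorphic O u v a b -> O z ->
  {for z, continuous u} /\ {for z, continuous v}.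
Proof.
move=> oO [ux uy vx vy ca cb] Oz.
have n : \forall w \near z, O w by exact: open_nbhs_nbhs.
split.
- apply: (@partials_continuous _ u a (- b)); last by apply: continuousN; exact: cb.
    by near do (split; [apply: ux|apply: uy]).
  exact: ca.
- apply: (@partials_continuous _ v b a).
  + by near do (split; [apply: vx|apply: vy]).
  + exact: cb.
  + exact: ca.
Unshelve. all: by end_near. Qed.

Lemma holo_cst O (c d : R) : holomorphic O (cst c) (cst d) 0 0.
Proof.
split=> z Oz; rewrite ?oppr0; try exact: is_derive_cst; exact: cst_continuous.
Qed.

Lemma is_derive_fst z (e : R * R) : is_derive z e (fst : R * R -> R) e.1.
Proof.
have H : (fun h : R => h^-1 *: ((fst \o shift z) (h *: e) - z.1)) @ 0^' --> e.1.
  apply: (cvg_trans (near_eq_cvg _) (cvg_cst e.1)).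
  near=> h => /=; rewrite addrK scalerA mulVf ?scale1r//.
  by near: h; exact: nbhs_dnbhs_neq.
by split; [apply/cvg_ex; exists e.1|exact/cvg_lim].
Unshelve. all: by end_near. Qed.

Lemma is_derive_snd z (e : R * R) : is_derive z e (snd : R * R -> R) e.2.
Proof.
have H : (fun h : R => h^-1 *: ((snd \o shift z) (h *: e) - z.2)) @ 0^' --> e.2.
  apply: (cvg_trans (near_eq_cvg _) (cvg_cst e.2)).
  near=> h => /=; rewrite addrK scalerA mulVf ?scale1r//.
  by near: h; exact: nbhs_dnbhs_neq.
by split; [apply/cvg_ex; exists e.2|exact/cvg_lim].
Unshelve. all: by end_near. Qed.

Lemma holo_id O : holomorphic O fst snd 1 0.
Proof.
split=> z Oz.
- exact: is_derive_fst.
- by rewrite oppr0; exact: is_derive_fst.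
- exact: is_derive_snd.
- exact: is_derive_snd.
- exact: cst_continuous.
- exact: cst_continuous.
Qed.

Lemma holo_add O u v a b u' v' a' b' :
  holomorphic O u v a b -> holomorphic O u' v' a' b' ->
  holomorphic O (u + u') (v + v') (a + a') (b + b').
Proof.
move=> [ux uy vx vy ca cb] [ux' uy' vx' vy' ca' cb']; split=> z Oz.
- exact: is_deriveD (ux z Oz) (ux' z Oz).
- by rewrite opprD; exact: is_deriveD (uy z Oz) (uy' z Oz).
- exact: is_deriveD (vx z Oz) (vx' z Oz).
- exact: is_deriveD (vy z Oz) (vy' z Oz).
- by apply: continuousD; [exact: ca|exact: ca'].
- by apply: continuousD; [exact: cb|exact: cb'].
Qed.

Lemma holo_mul O u v a b u' v' a' b' : open O ->
  holomorphic O u v a b -> holomorphic O u' v' a' b' ->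
  holomorphic O (u * u' - v * v') (u * v' + v * u')
    ((a * u' - b * v') + (u * a' - v * b'))
    ((a * v' + b * u') + (u * b' + v * a')).
Proof.
move=> oO h h'.
have cc z (Oz : O z) := holo_continuous _ _ _ _ _ _ oO h Oz.
have cc' z (Oz : O z) := holo_continuous _ _ _ _ _ _ oO h' Oz.
move: h h' => [ux uy vx vy ca cb] [ux' uy' vx' vy' ca' cb'].
split=> z Oz.
- apply: is_derive_eq (is_deriveB (is_deriveM (ux z Oz) (ux' z Oz))
   (is_deriveM (vx z Oz) (vx' z Oz))) _.
  by rewrite /GRing.scale /= !fctE; ring.
- apply: is_derive_eq (is_deriveB (is_deriveM (uy z Oz) (uy' z Oz))
   (is_deriveM (vy z Oz) (vy' z Oz))) _.
  by rewrite /GRing.scale /= !fctE; ring.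
- apply: is_derive_eq (is_deriveD (is_deriveM (ux z Oz) (vx' z Oz))
   (is_deriveM (vx z Oz) (ux' z Oz))) _.
  by rewrite /GRing.scale /= !fctE; ring.
- apply: is_derive_eq (is_deriveD (is_deriveM (uy z Oz) (vy' z Oz))
   (is_deriveM (vy z Oz) (uy' z Oz))) _.
  by rewrite /GRing.scale /= !fctE; ring.
- have [? ?] := cc z Oz; have [? ?] := cc' z Oz.
  by apply: continuousD; apply: continuousB; apply: continuousM; auto.
- have [? ?] := cc z Oz; have [? ?] := cc' z Oz.
  by apply: continuousD; apply: continuousD; apply: continuousM; auto.
Qed.

Definition sqmod (u v : R * R -> R) : R * R -> R := u * u + v * v.

Lemma sqmod_ge0 u v z : 0 <= sqmod u v z.
Proof. by rewrite /sqmod !fctE addr_ge0 // -expr2 sqr_ge0. Qed.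

Lemma sqmod_le0 u v z : sqmod u v z <= 0 -> u z = 0 /\ v z = 0.
Proof.
move=> h; have /eqP : sqmod u v z = 0 by apply/eqP; rewrite eq_le h sqmod_ge0.
rewrite /sqmod !fctE -!expr2 paddr_eq0 ?sqr_ge0// !sqrf_eq0.
by move=> /andP[/eqP ? /eqP ?].
Qed.

Lemma sqmod_root u v z : u z = 0 -> v z = 0 -> sqmod u v z = 0.
Proof. by move=> uz vz; rewrite /sqmod !fctE uz vz !mulr0 addr0. Qed.

Lemma is_deriveV (f : R * R -> R) z (e : R * R) df : f z != 0 -> is_derive z e f df ->
  is_derive z e (fun y => (f y)^-1) (- (f z) ^- 2 * df).
Proof.
move=> f0 [d1 <-]; split; [exact: derivableV|exact: deriveV].
Qed.

Lemma continuousVf (f : R * R -> R) z : f z != 0 ->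
  {for z, continuous f} -> {for z, continuous (fun y => (f y)^-1)}.
Proof. by move=> f0 cf; apply: (@cvgV _ _ (nbhs z) _ f (f z)). Qed.

Definition inv_re u v : R * R -> R := u * (fun z => (sqmod u v z)^-1).
Definition inv_im u v : R * R -> R := - v * (fun z => (sqmod u v z)^-1).

(** The derivative of [1/h] is [- h' (1/h)^2], which is the formula below in
    real and imaginary parts. *)
Lemma holo_inv O u v a b : open O -> (forall z, O z -> sqmod u v z != 0) ->
  holomorphic O u v a b ->
  holomorphic O (inv_re u v) (inv_im u v)
    (- (a * (inv_re u v * inv_re u v - inv_im u v * inv_im u v)
         - b * (inv_re u v * inv_im u v + inv_im u v * inv_re u v)))
    (- (a * (inv_re u v * inv_im u v + inv_im u v * inv_re u v)
         + b * (inv_re u v * inv_re u v - inv_im u v * inv_im u v))).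
Proof.
move=> oO h0 h.
have cc z (Oz : O z) := holo_continuous _ _ _ _ _ _ oO h Oz.
move: h => [ux uy vx vy ca cb].
have dm z (e : R * R) du dv : is_derive z e u du -> is_derive z e v dv ->
    is_derive z e (sqmod u v) (2 * (u z * du + v z * dv)).
  move=> hu hv; apply: is_derive_eq (is_deriveD (is_deriveM hu hu) (is_deriveM hv hv)) _.
  by rewrite /GRing.scale /=; ring.
have cm z : O z -> {for z, continuous (sqmod u v)}.
  by move=> Oz; have [? ?] := cc z Oz; apply: continuousD; exact: continuousM.
have ci z : O z -> {for z, continuous (inv_re u v)} /\ {for z, continuous (inv_im u v)}.
  move=> Oz; have [? ?] := cc z Oz.
  have ? := continuousVf _ _ (h0 z Oz) (cm z Oz).
  by split; apply: continuousM => //; exact: continuousN.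
have di z (e : R * R) du dv : O z -> is_derive z e u du -> is_derive z e v dv ->
    is_derive z e (inv_re u v)
     (du / sqmod u v z - u z * (2 * (u z * du + v z * dv)) / sqmod u v z ^+ 2) /\
    is_derive z e (inv_im u v)
     (- dv / sqmod u v z + v z * (2 * (u z * du + v z * dv)) / sqmod u v z ^+ 2).
  move=> Oz hu hv.
  have hi := is_deriveV _ _ _ _ (h0 z Oz) (dm _ _ _ _ hu hv).
  split.
    apply: is_derive_eq (is_deriveM hu hi) _.
    by rewrite /GRing.scale /=; ring.
  apply: is_derive_eq (is_deriveM (is_deriveN hv) hi) _.
  by rewrite /GRing.scale /= !fctE; ring.
have sE z : sqmod u v z = u z * u z + v z * v z by [].
have F z : O z -> u z * u z + v z * v z != 0 by move=> Oz; rewrite -sE; exact: h0.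
split=> z Oz.
- apply: is_derive_eq (di _ _ _ _ Oz (ux z Oz) (vx z Oz)).1 _.
  by rewrite /inv_re /inv_im !fctE !sE; field; exact: F.
- apply: is_derive_eq (di _ _ _ _ Oz (uy z Oz) (vy z Oz)).1 _.
  by rewrite /inv_re /inv_im !fctE !sE; field; exact: F.
- apply: is_derive_eq (di _ _ _ _ Oz (ux z Oz) (vx z Oz)).2 _.
  by rewrite /inv_re /inv_im !fctE !sE; field; exact: F.
- apply: is_derive_eq (di _ _ _ _ Oz (uy z Oz) (vy z Oz)).2 _.
  by rewrite /inv_re /inv_im !fctE !sE; field; exact: F.
- have [? ?] := ci z Oz; apply: continuousN; apply: continuousB;
   apply: continuousM; auto; [apply: continuousB|apply: continuousD]; exact: continuousM.
- have [? ?] := ci z Oz; apply: continuousN; apply: continuousD;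
   apply: continuousM; auto; [apply: continuousD|apply: continuousB]; exact: continuousM.
Qed.

(** The last clause says that the quotient inherits critical zeros of the
    numerator, the condition under which the Schwarz lemma below applies to it. *)
Lemma holo_quotient O u v a b u' v' a' b' : open O ->
  (forall z, O z -> sqmod u' v' z != 0) ->
  holomorphic O u v a b -> holomorphic O u' v' a' b' ->
  exists gu gv ga gb, [/\ holomorphic O gu gv ga gb,
    forall z, gu z = (u z * u' z + v z * v' z) / sqmod u' v' z,
    forall z, gv z = (v z * u' z - u z * v' z) / sqmod u' v' z,
    forall z, sqmod u' v' z != 0 -> sqmod gu gv z = sqmod u v z / sqmod u' v' z &
    forall z, u z = 0 -> v z = 0 -> a z = 0 -> b z = 0 -> ga z = 0 /\ gb z = 0].
Proof.
move=> oO q0 h h'.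
have hg := holo_mul _ _ _ _ _ _ _ _ _ oO h (holo_inv _ _ _ _ _ oO q0 h').
set gu := (u * _ - _) in hg; set gv := (u * _ + _) in hg.
have guE z : gu z = (u z * u' z + v z * v' z) / sqmod u' v' z.
  by rewrite /gu /inv_re /inv_im !fctE; ring.
have gvE z : gv z = (v z * u' z - u z * v' z) / sqmod u' v' z.
  by rewrite /gv /inv_re /inv_im !fctE; ring.
eexists gu, gv, _, _; split; [exact: hg|exact: guE|exact: gvE| |].
- move=> z zq; rewrite [LHS]/sqmod !fctE guE gvE.
  have : u' z * u' z + v' z * v' z != 0 by [].
  by rewrite /sqmod !fctE => ?; field.
- by move=> z uz vz az bz; rewrite /inv_re /inv_im !fctE /= uz vz az bz !mul0r !subr0 !addr0.
Qed.

Definition dist2 p z : R := (z.1 - p.1) ^+ 2 + (z.2 - p.2) ^+ 2.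

Lemma dist2_ge0 p z : 0 <= dist2 p z.
Proof. by rewrite addr_ge0 ?sqr_ge0. Qed.

Lemma dist2_gt0 p z : z <> p -> 0 < dist2 p z.
Proof.
move=> zp; rewrite lt0r dist2_ge0 andbT; apply/eqP => /eqP.
rewrite paddr_eq0 ?sqr_ge0// !sqrf_eq0 !subr_eq0 => /andP[/eqP h1 /eqP h2].
by apply: zp; rewrite [z]surjective_pairing h1 h2 -surjective_pairing.
Qed.

Lemma open_remove_point O p : open O -> open (O `\ p).
Proof.
move=> oO; rewrite setDE; apply: openI => //; apply: closed_openC.
by apply: accessible_closed_set1; apply: hausdorff_accessible; exact: norm_hausdorff.
Qed.

(** Division of [u + i v] by [z - p]. The value of the quotient at [p] itself is
    0, since the inverse of 0 is 0. *)
Lemma holo_divide_center O p u v a b : open O -> holomorphic O u v a b ->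
  exists gu gv ga gb, [/\ holomorphic (O `\ p) gu gv ga gb,
    forall z, gu z = (u z * (z.1 - p.1) + v z * (z.2 - p.2)) / dist2 p z,
    forall z, gv z = (v z * (z.1 - p.1) - u z * (z.2 - p.2)) / dist2 p z,
    forall z, z <> p -> sqmod gu gv z = sqmod u v z / dist2 p z &
    forall z, u z = 0 -> v z = 0 -> a z = 0 -> b z = 0 -> ga z = 0 /\ gb z = 0].
Proof.
move=> oO h.
have hX := holo_add _ _ _ _ _ _ _ _ _ (holo_id (O `\ p))
  (holo_cst (O `\ p) (- p.1) (- p.2)).
have q0 z : z <> p -> sqmod (fst + cst (- p.1)) (snd + cst (- p.2)) z != 0.
  by move=> zp; apply: lt0r_neq0 (dist2_gt0 _ _ zp).
have [gu [gv [ga [gb [hg guE gvE gsq g0]]]]] := holo_quotient _ _ _ _ _ _ _ _ _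
  (open_remove_point _ p oO) (fun z hz => q0 z hz.2)
  (holo_sub _ _ _ _ _ _ (@subDsetl _ _ _) h) hX.
by exists gu, gv, ga, gb; split=> // z /q0 /gsq.
Qed.

End Holo.

(** * A horizontal primitive *)

Section Primitive.
Context {R : realType}.
Implicit Types (u v a b f : R * R -> R) (z w p : R * R) (O : set (R * R)).
Notation mu := (@lebesgue_measure R).

Lemma is_derive_continuous (g : R -> R) (x l : R) : is_derive x 1 g l -> {for x, continuous g}.
Proof. by move=> [d _]; exact/differentiable_continuous/derivable1_diffP. Qed.

Lemma slice_continuous f z : {for z, continuous f} -> {for z.1, continuous (fun x => f (x, z.2))}.
Proof.
case: z => x y cf /=.
apply: (@cvg_comp _ _ _ (fun s : R => (s, y)) f _ (nbhs (x, y))) => //.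
apply: (@cvg_pair _ _ _ (nbhs x) (nbhs x) (nbhs y) _ _ _ id (cst y)).
  exact: cvg_id.
exact: cvg_cst.
Qed.

(** Averages of [u] over short horizontal segments are difference quotients of
    this function. *)
Definition xprimitive u (c : R) z : R := \int[mu]_(s in `[c, z.1]) u (s, z.2).

(** The vertical derivative is obtained by differentiating under the integral
    sign: the Cauchy-Riemann equation turns the vertical derivative of [u] into
    minus the horizontal derivative of [v], which integrates to a difference of
    values of [v]. So the primitive has [C^1] partial derivatives, one order more
    than is known of [u]. *)
Lemma xprimitive_partials u v a b p (r rho C : R) : r < rho ->
  holomorphic (box p rho) u v a b -> (forall z, box p rho z -> `|b z| <= C) ->
  forall z, box p r z ->
    is_derive z (1, 0) (xprimitive u (p.1 - r)) (u z) /\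
    is_derive z (0, 1) (xprimitive u (p.1 - r)) (v (p.1 - r, z.2) - v z).
Proof.
move=> rrho [ux uy vx vy ca cb] hC [x y] [/= hx hy].
move: (hx) (hy); rewrite !ltr_distl => /andP[x1 x2] /andP[y1 y2].
have inb s t : p.1 - r <= s -> s <= p.1 + r -> `|t - p.2| < r -> box p rho (s, t).
  by move=> s1 s2 ht; split => /=; [rewrite ltr_distl; lra|exact: lt_trans rrho].
have cu (s t : R) : p.1 - r <= s -> s <= p.1 + r -> `|t - p.2| < r ->
    {for s, continuous (fun s => u (s, t))}.
  move=> s1 s2 ht; apply: (@is_derive_continuous _ _ (a (s, t))).
  by apply: (is_derive_slice1 _ (s, t) _).1; apply: ux; exact: inb.
have intu t s2 : s2 <= p.1 + r -> `|t - p.2| < r ->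
    mu.-integrable `[p.1 - r, s2] (EFin \o (fun s => u (s, t))).
  move=> hs ht; apply: continuous_compact_integrable; first exact: segment_compact.
  apply: continuous_in_subspaceT => s; rewrite inE /= in_itv /= => /andP[? ?].
  by apply: cu => //; exact: le_trans hs.
split.
- apply/is_derive_slice1 => /=.
  have [| | |dF F'] := @continuous_FTC1_closed _ (fun s => u (s, y)) (p.1 - r) x (p.1 + r) x2.
  + exact: intu.
  + exact: x1.
  + by apply: cu => //; exact: ltW.
  by split; [exact: dF|rewrite -derive1E; exact: F'].
- apply/is_derive_slice2 => /=.
  have iy : `]p.2 - r, p.2 + r[%classic y by rewrite /= in_itv /= y1 y2.
  have dist t : `]p.2 - r, p.2 + r[%classic t -> `|t - p.2| < r.
    by rewrite /= in_itv /= ltr_distl.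
  have duy s t : `[p.1 - r, x]%classic s -> `|t - p.2| < r ->
      is_derive t 1 (fun t => u (s, t)) (- b (s, t)).
    rewrite /= in_itv /= => /andP[s1 s2] ht.
    apply: (is_derive_slice2 _ (s, t) _).1; apply: uy; apply: inb => //.
    by apply: le_trans s2 (ltW x2).
  have i1 t : `]p.2 - r, p.2 + r[%classic t ->
      mu.-integrable `[p.1 - r, x] (EFin \o (fun s => u (s, t))).
    by move=> /dist ht; apply: intu => //; exact: ltW.
  have i2 t s : `]p.2 - r, p.2 + r[%classic t -> `[p.1 - r, x]%classic s ->
      derivable (fun t => u (s, t)) t 1.
    by move=> /dist ht /duy /(_ ht)[].
  have d1E t s : `]p.2 - r, p.2 + r[%classic t -> `[p.1 - r, x]%classic s ->
      partial1of2 (fun t s => u (s, t)) t s = - b (s, t).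
    by move=> /dist ht /duy /(_ ht)[_ <-]; rewrite partial1of2E.
  have C0 : 0 <= C.
    by apply: le_trans (normr_ge0 _) (hC (p.1, y) _); apply: inb => //; lra.
  have i3 t s : `]p.2 - r, p.2 + r[%classic t -> `[p.1 - r, x]%classic s ->
      `|partial1of2 (fun t s => u (s, t)) t s| <= C.
    move=> ht hs; rewrite d1E// normrN; apply: hC; move: hs.
    rewrite /= in_itv /= => /andP[? ?]; apply: inb => //; last exact: dist.
    by lra.
  have iC : mu.-integrable `[p.1 - r, x] (EFin \o (fun=> C)).
    apply: continuous_compact_integrable; first exact: segment_compact.
    by apply: continuous_subspaceT => s; exact: cst_continuous.
  have mI : measurable `[p.1 - r, x]%classic by [].
  have D1 := @derivable_under_integral R _ _ mu (fun t s => u (s, t)) _ mI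
    y _ _ iy i1 i2 (fun=> C) (fun=> C0) iC i3.
  have D2 := @differentiation_under_integral R _ _ mu (fun t s => u (s, t)) _ mI
    y _ _ iy i1 i2 (fun=> C) (fun=> C0) iC i3.
  split; first exact: D1.
  rewrite -derive1E [LHS]D2.
  transitivity (\int[mu]_(s in `[p.1 - r, x]) (- b (s, y))).
    by apply: eq_Rintegral => s; rewrite inE => hs; rewrite d1E.
  rewrite /Rintegral.
  have dv s : p.1 - r <= s -> s <= x -> is_derive s 1 (fun s => - v (s, y)) (- b (s, y)).
    move=> s1 s2; apply: is_deriveN; apply: (is_derive_slice1 _ (s, y) _).1.
    by apply: vx; apply: inb => //; lra.
  rewrite (@continuous_FTC2 _ _ (fun s => - v (s, y)))//=.
  + by rewrite opprK addrC.
  + apply: continuous_in_subspaceT => s; rewrite inE /= in_itv /= => /andP[? ?].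
    apply: continuousN; apply: (slice_continuous _ (s, y)); apply: cb.
    by apply: inb => //; lra.
  + split.
    * by move=> s; rewrite in_itv /= => /andP[? ?]; have [] := dv s => //; exact: ltW.
    * apply: cvg_at_right_filter.
      apply: (@is_derive_continuous (fun s => - v (s, y)) _ (- b (p.1 - r, y))).
      by apply: dv => //; exact: ltW.
    * apply: cvg_at_left_filter.
      apply: (@is_derive_continuous (fun s => - v (s, y)) _ (- b (x, y))).
      by apply: dv => //; exact: ltW.
  + move=> s; rewrite in_itv /= => /andP[? ?].
    by rewrite derive1E; have [||_ ->] := dv s => //; exact: ltW.
Qed.
End Primitive.

(** * The maximum principle at one point *)

Section NoMax.
Context {R : realType}.
Implicit Types (u v a b f : R * R -> R) (z w p : R * R) (O : set (R * R)).

Lemma is_derive_translate f z (d e : R * R) l :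
  is_derive (z + d) e f l -> is_derive z e (fun w => f (w + d)) l.
Proof.
have E : (fun h : R => h^-1 *: (((fun w => f (w + d)) \o shift z) (h *: e) - f (z + d))) =
  (fun h : R => h^-1 *: ((f \o shift (z + d)) (h *: e) - f (z + d))).
  by apply/funext => h /=; rewrite addrA.
by move=> -[d1 d2]; split; [move: d1; rewrite /derivable E|move: d2; rewrite /derive E].
Qed.

Lemma continuous_translate f z (d : R * R) :
  {for z + d, continuous f} -> {for z, continuous (fun w => f (w + d))}.
Proof.
move=> cf; apply: (@cvg_comp _ _ _ (fun w : R * R => w + d) f _ (nbhs (z + d))) => //.
by apply: cvgD; [exact: cvg_id|exact: cvg_cst].
Qed.

Lemma nbhs_slice1 z (P : set (R * R)) : nbhs z P -> \forall x \near z.1, P (x, z.2).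
Proof.
move=> /nbhs_boxP[r r0 h]; apply/nbhs_ballP; exists r => // x hx; apply: h.
by split => /=; rewrite ?subrr ?normr0//; move: hx; rewrite /ball /= distrC.
Qed.

Lemma nbhs_slice2 z (P : set (R * R)) : nbhs z P -> \forall y \near z.2, P (z.1, y).
Proof.
move=> /nbhs_boxP[r r0 h]; apply/nbhs_ballP; exists r => // x hx; apply: h.
by split => /=; rewrite ?subrr ?normr0//; move: hx; rewrite /ball /= distrC.
Qed.

Lemma nbhs_box p (r : R) z : box p r z -> nbhs z (box p r).
Proof. by rewrite box_ball => h; apply: open_nbhs_nbhs; split => //; exact: ball_open. Qed.

Lemma maximum_laplacian (G Gx Gy : R * R -> R) z (gxx gyy : R) :
  (\forall w \near z, is_derive (w : R * R) (1, 0) G (Gx w)) ->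
  (\forall w \near z, is_derive (w : R * R) (0, 1) G (Gy w)) ->
  is_derive z (1, 0) Gx gxx -> is_derive z (0, 1) Gy gyy ->
  (\forall w \near z, G w <= G z) -> gxx + gyy <= 0.
Proof.
move=> hx hy hxx hyy hm.
have H1 : gxx <= 0.
  apply: (@second_derivative_test R (fun x => G (x, z.2)) (fun x => Gx (x, z.2)) z.1).
  - by apply: filterS (nbhs_slice1 _ _ hx) => x /is_derive_slice1.
  - exact/is_derive_slice1.
  - by rewrite -surjective_pairing; exact: (nbhs_slice1 _ _ hm).
have H2 : gyy <= 0.
  apply: (@second_derivative_test R (fun y => G (z.1, y)) (fun y => Gy (z.1, y)) z.2).
  - by apply: filterS (nbhs_slice2 _ _ hy) => x /is_derive_slice2.
  - exact/is_derive_slice2.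
  - by rewrite -surjective_pairing; exact: (nbhs_slice2 _ _ hm).
by lra.
Qed.

Lemma is_derive_sqr f z (e : R * R) l :
  is_derive z e f l -> is_derive z e (f * f) (2 * f z * l).
Proof.
by move=> h; apply: is_derive_eq (is_deriveM h h) _; rewrite /GRing.scale /=; ring.
Qed.

Lemma is_derive_fstB z (e : R * R) (c : R) :
  is_derive z e ((fst : R * R -> R) - cst c) e.1.
Proof.
by apply: is_derive_eq (is_deriveB (is_derive_fst z e) (is_derive_cst c z e)) _; rewrite subr0.
Qed.

Lemma is_derive_sndB z (e : R * R) (c : R) :
  is_derive z e ((snd : R * R -> R) - cst c) e.2.
Proof.
by apply: is_derive_eq (is_deriveB (is_derive_snd z e) (is_derive_cst c z e)) _; rewrite subr0.
Qed.

Lemma continuous_fst z : {for z, continuous (fst : R * R -> R)}.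
Proof. exact: cvg_fst. Qed.

Lemma continuous_snd z : {for z, continuous (snd : R * R -> R)}.
Proof. exact: cvg_snd. Qed.

(** The maximum principle for a real part [u] that is only known to be [C^1]. If [u]
    were of class [C^2], its Laplacian would vanish, that of [u] plus the quadratic
    term would be [2 delta > 0], and [maximum_laplacian] would conclude. In general [u] is
    replaced by its average [s * Q] over a horizontal segment of length [t]: this
    is [C^2] and harmonic, and it differs from [u] by at most [C * t]. Subtracting
    [e] times the squared distance to [z0], with [e] small enough to keep the
    Laplacian positive, makes the maximum strict, so that it survives the
    perturbation when [t] is small. *)
Lemma no_local_max O u v a b z0 (c delta : R) : open O -> holomorphic O u v a b -> O z0 ->
  0 < delta ->
  ~ (\forall z \near z0, u z + delta * (z.1 - c) ^+ 2 <= u z0 + delta * (z0.1 - c) ^+ 2).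
Proof.
move=> oO h Oz0 d0 hmax.
have /nbhs_boxP[r r0 hr] : \forall z \near z0,
  [/\ O z, u z + delta * (z.1 - c) ^+ 2 <= u z0 + delta * (z0.1 - c) ^+ 2,
      `|a z| <= `|a z0| + 1 & `|b z| <= `|b z0| + 1].
  have n : \forall w \near z0, O w by exact: open_nbhs_nbhs.
  have := continuous_bounded_near _ _ (holo_ca _ _ _ _ _ h z0 Oz0).
  have := continuous_bounded_near _ _ (holo_cb _ _ _ _ _ h z0 Oz0).
  move=> cb ca; apply: filterS (filterI (filterI n hmax) (filterI ca cb)).
  by move=> z [[? ?] [? ?]].
pose C := `|a z0| + 1 + (`|b z0| + 1).
have [na nb] := (normr_ge0 (a z0), normr_ge0 (b z0)).
have C0 : 0 < C by rewrite /C; lra.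
have ha z : box z0 r z -> `|a z| <= C by move=> /hr[_ _ + _]; rewrite /C; lra.
have hb z : box z0 r z -> `|b z| <= C by move=> /hr[_ _ _]; rewrite /C; lra.
have {}h : holomorphic (box z0 r) u v a b by apply: holo_sub h => z /hr[].
have hcont z : box z0 r z -> {for z, continuous u} /\ {for z, continuous v}.
  move=> bz; apply: (holo_continuous (box z0 r) _ _ a b) => //.
  by rewrite box_ball; exact: ball_open.
have [ux uy vx vy ca cb] := h.
have r2r : r / 2 < r by lra.
have HP := @xprimitive_partials R u v a b z0 (r / 2) r C r2r h hb.
set P := xprimitive u (z0.1 - r / 2) in HP.
pose r4 := r / 4.
(* t <= r / 8 keeps translated points in the domain of the primitive; the other
   bound makes the error C * t small against the drop e * r4 ^+ 2 at the boundary *)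
pose t := Num.min (r / 8) (delta * r4 ^+ 2 / (16 * C)).
have r40 : 0 < r4 by rewrite /r4; lra.
have t0 : 0 < t.
  rewrite lt_min; apply/andP; split; first by lra.
  by rewrite divr_gt0// mulr_gt0// exprn_gt0.
have tr : t <= r / 8 by rewrite ge_min lexx.
have tC : C * t <= delta * r4 ^+ 2 / 16.
  have : t <= delta * r4 ^+ 2 / (16 * C) by rewrite ge_min lexx orbT.
  move=> /(ler_wpM2l (ltW C0)) /le_trans; apply.
  by rewrite le_eqVlt; apply/orP; left; apply/eqP; field; rewrite gt_eqF.
pose d : R * R := (t, 0).
pose B := box z0 (3 * r / 8).
have Bin z : B z -> box z0 (r / 2) z.
  by move=> [h1 h2]; split; apply: lt_trans; [exact: h1| |exact: h2|]; lra.
have Bd z : B z -> box z0 (r / 2) (z + d).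
  move=> [+ +]; rewrite !ltr_distl => /andP[? ?] /andP[? ?].
  by split => /=; rewrite ltr_distl /=; apply/andP; split; lra.
have big z : box z0 (r / 2) z -> box z0 r z.
  by move=> [h1 h2]; split; apply: lt_trans; [exact: h1| |exact: h2|]; lra.
pose Q : R * R -> R := (fun w => P (w + d)) - P.
have Qx z : B z -> is_derive z (1, 0) Q (u (z + d) - u z).
  move=> Bz; apply: is_deriveB; last exact: (HP _ (Bin _ Bz)).1.
  by apply: is_derive_translate; exact: (HP _ (Bd _ Bz)).1.
have Qy z : B z -> is_derive z (0, 1) Q (v z - v (z + d)).
  move=> Bz; apply: is_derive_eq.
    apply: is_deriveB; last exact: (HP _ (Bin _ Bz)).2.
    by apply: is_derive_translate; exact: (HP _ (Bd _ Bz)).2.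
  by rewrite /= addr0; ring.
have openB : open B by rewrite /B box_ball; exact: ball_open.
pose s : R := t^-1.
have s0 : 0 < s by rewrite invr_gt0.
pose X1 : R * R -> R := fst - cst c.
pose X2 : R * R -> R := fst - cst z0.1.
pose Y2 : R * R -> R := snd - cst z0.2.
pose e := delta / 4.
pose G : R * R -> R := s *: Q + delta *: (X1 * X1) - (e *: (X2 * X2) + e *: (Y2 * Y2)).
pose Gx z := s * (u (z + d) - u z) + 2 * delta * (z.1 - c) - 2 * e * (z.1 - z0.1).
pose Gy z := s * (v z - v (z + d)) - 2 * e * (z.2 - z0.2).
have GxP z : B z -> is_derive z (1, 0) G (Gx z).
  move=> Bz.
  apply: is_derive_eq (is_deriveB (is_deriveD (is_deriveZ s (Qx z Bz))
    (is_deriveZ delta (is_derive_sqr _ _ _ _ (is_derive_fstB z (1, 0) c))))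
    (is_deriveD (is_deriveZ e (is_derive_sqr _ _ _ _ (is_derive_fstB z (1, 0) z0.1)))
     (is_deriveZ e (is_derive_sqr _ _ _ _ (is_derive_sndB z (1, 0) z0.2))))) _.
  by rewrite /Gx /GRing.scale /= !fctE /=; ring.
have GyP z : B z -> is_derive z (0, 1) G (Gy z).
  move=> Bz.
  apply: is_derive_eq (is_deriveB (is_deriveD (is_deriveZ s (Qy z Bz))
    (is_deriveZ delta (is_derive_sqr _ _ _ _ (is_derive_fstB z (0, 1) c))))
    (is_deriveD (is_deriveZ e (is_derive_sqr _ _ _ _ (is_derive_fstB z (0, 1) z0.1)))
     (is_deriveZ e (is_derive_sqr _ _ _ _ (is_derive_sndB z (0, 1) z0.2))))) _.
  by rewrite /Gy /GRing.scale /= !fctE /=; ring.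
have GxxP z : B z -> is_derive z (1, 0) Gx (s * (a (z + d) - a z) + 2 * delta - 2 * e).
  move=> Bz.
  apply: is_derive_eq (is_deriveB (is_deriveD (is_deriveZ s (is_deriveB
    (is_derive_translate _ _ _ _ _ (ux (z + d) (big _ (Bd _ Bz)))) (ux z (big _ (Bin _ Bz)))))
    (is_deriveZ (2 * delta) (is_derive_fstB z (1, 0) c)))
    (is_deriveZ (2 * e) (is_derive_fstB z (1, 0) z0.1))) _.
  by rewrite /GRing.scale /=; ring.
have GyyP z : B z -> is_derive z (0, 1) Gy (s * (a z - a (z + d)) - 2 * e).
  move=> Bz.
  apply: is_derive_eq (is_deriveB (is_deriveZ s (is_deriveB
    (vy z (big _ (Bin _ Bz))) (is_derive_translate _ _ _ _ _ (vy (z + d) (big _ (Bd _ Bz))))))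
    (is_deriveZ (2 * e) (is_derive_sndB z (0, 1) z0.2))) _.
  by rewrite /GRing.scale /=; ring.
have GC z : B z -> {for z, continuous G}.
  move=> Bz.
  have [cu cv] := hcont _ (big _ (Bin _ Bz)).
  have [cu' cv'] := hcont _ (big _ (Bd _ Bz)).
  have {}cu' := continuous_translate _ _ _ cu'.
  have {}cv' := continuous_translate _ _ _ cv'.
  have cX1 : {for z, continuous X1}.
    by apply: continuousB; [exact: continuous_fst|exact: cst_continuous].
  have cX2 : {for z, continuous X2}.
    by apply: continuousB; [exact: continuous_fst|exact: cst_continuous].
  have cY2 : {for z, continuous Y2}.
    by apply: continuousB; [exact: continuous_snd|exact: cst_continuous].
  apply: (@partials_continuous _ G Gx Gy).
  - by apply: filterS (nbhs_box _ _ _ Bz) => w Bw; split; [exact: GxP|exact: GyP].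
  - have : {for z, continuous (cst s * ((fun z => u (z + d)) - u) + cst (2 * delta) * X1
                                - cst (2 * e) * X2)}.
      apply: continuousB; first apply: continuousD.
      + by apply: continuousM; [exact: cst_continuous|exact: continuousB].
      + by apply: continuousM => //; exact: cst_continuous.
      + by apply: continuousM => //; exact: cst_continuous.
    exact.
  - have : {for z, continuous (cst s * (v - (fun z => v (z + d))) - cst (2 * e) * Y2)}.
      apply: continuousB.
      + by apply: continuousM; [exact: cst_continuous|exact: continuousB].
      + by apply: continuousM => //; exact: cst_continuous.
    exact.
have QuC z : B z -> `|s * Q z - u z| <= C * t.
  case: z => x y Bz.
  have inseg (w : R) : x <= w -> w <= x + t -> box z0 (r / 2) (w, y).
    move=> w1 w2; have [/= + +] := Bin _ Bz; have [/= + +] := Bd _ Bz.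
    rewrite /= addr0 !ltr_distl => /andP[? ?] _ /andP[? ?] hy; split => /=; rewrite ltr_distl //.
    by apply/andP; split; lra.
  have dP : forall q : R, x <= q -> q <= x + t ->
      is_derive q 1 (fun q0 : R => P (q0, y)) (u (q, y)).
    move=> q w1 w2; apply: (is_derive_slice1 _ (q, y) _).1.
    by apply: (HP _ _).1; exact: inseg.
  have [|||xi] := @MVT _ (fun q : R => P (q, y)) (fun q : R => u (q, y)) x (x + t).
  - by lra.
  - by move=> q; rewrite in_itv /= => /andP[? ?]; apply: dP; lra.
  - apply: derivable_within_continuous => w; rewrite in_itv /= => /andP[? ?].
    by have [] // := dP w.
  rewrite in_itv /= => /andP[xi1 xi2].
  have -> : x + t - x = t by ring.
  move=> E; have -> : s * Q (x, y) = u (xi, y).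
    have Ed : (x, y) + d = (x + t, y) by rewrite -[y in RHS]addr0.
    have -> : Q (x, y) = u (xi, y) * t by rewrite -E /Q !fctE /= Ed.
    by rewrite /s; field; rewrite gt_eqF.
  have hb' : forall w, box z0 r w -> `|(- b) w| <= C.
    by move=> w bw; rewrite fctE normrN; exact: hb.
  have b1 : box z0 r (xi, y) by apply: big; apply: inseg; lra.
  have b2 : box z0 r (x, y) by apply: big; apply: Bin.
  apply: le_trans (partials_lipschitz u a (- b) z0 r C ux uy ha hb' _ _ b1 b2) _.
  by rewrite /= subrr normr0 addr0 ler_pM2l// ger0_norm; lra.
have cB : cbox z0 r4 `<=` B by apply: box_cbox; rewrite /r4; lra.
have Bz0 : cbox z0 r4 z0 by split; rewrite subrr normr0 ltW.
have [||m mB Gm] := @compact_EVT_max _ _ G (cbox z0 r4) (ex_intro _ z0 Bz0).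
- exact: compact_cbox.
- by apply: continuous_in_subspaceT => z; rewrite inE => /cB; exact: GC.
rewrite inE in mB.
have GE z : G z = s * Q z + delta * (z.1 - c) ^+ 2 -
  (e * (z.1 - z0.1) ^+ 2 + e * (z.2 - z0.2) ^+ 2) by [].
(* G at its maximum m over the closed box, bounded from below through the centre
   and from above through the assumed local maximum of the unperturbed function *)
have low : u z0 + delta * (z0.1 - c) ^+ 2 - C * t <= G m.
  apply: le_trans (Gm z0 _); last by rewrite inE.
  have := QuC z0 (cB _ Bz0).
  rewrite GE !subrr expr0n /= mulr0 ler_distl => /andP[? ?]; lra.
have up : G m <= u z0 + delta * (z0.1 - c) ^+ 2 + C * t -
    (e * (m.1 - z0.1) ^+ 2 + e * (m.2 - z0.2) ^+ 2).
  have := QuC m (cB _ mB); rewrite GE ler_distl => /andP[_ ?].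
  have [_ ? _ _] := hr m (big _ (Bin _ (cB _ mB))); lra.
have inside : box z0 r4 m.
  have K : e * (m.1 - z0.1) ^+ 2 + e * (m.2 - z0.2) ^+ 2 < e * r4 ^+ 2.
    have : 0 < delta * r4 ^+ 2 by rewrite mulr_gt0// exprn_gt0.
    have -> : e * r4 ^+ 2 = delta * r4 ^+ 2 / 4 by rewrite /e; ring.
    by move: tC low up; lra.
  rewrite -mulrDr ltr_pM2l in K; last by rewrite /e; lra.
  split; rewrite -(@ltr_pXn2r _ 2)// ?nnegrE// ?(ltW r40)// real_normK ?num_real//;
   apply: le_lt_trans K; rewrite ?lerDl ?lerDr sqr_ge0//.
have Bm := cB _ mB.
have nB : \forall w \near m, B w by exact: nbhs_box.
(* the contributions of the average to the two second derivatives cancel *)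
have : s * (a (m + d) - a m) + 2 * delta - 2 * e + (s * (a m - a (m + d)) - 2 * e) <= 0.
  apply: (@maximum_laplacian G Gx Gy m).
  - by apply: filterS nB => w; exact: GxP.
  - by apply: filterS nB => w; exact: GyP.
  - exact: GxxP.
  - exact: GyyP.
  - apply: filterS (nbhs_box _ _ _ inside) => w /cbox_box hw.
    by apply: Gm; rewrite inE.
by rewrite /e; lra.
Qed.

End NoMax.

(** * The Schwarz lemma *)

Section Schwarz.
Context {R : realType}.
Implicit Types (u v a b f : R * R -> R) (z w p : R * R) (O : set (R * R)).

(** Weak maximum modulus principle on a box, allowing one interior zero [p] at which
    only continuity is required. If the modulus at [z1] exceeded its bound on the
    boundary, then the real part [U] of the function multiplied by the conjugate of
    its value at [z1] would be larger at [z1] than on the boundary; adding a small multiple of [(z.1 - p.1)^2] does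
    not change this, and a maximum point of the sum over the box is then neither on
    the boundary nor equal to [p], against [no_local_max]. *)
Lemma weak_max O p (r m2 : R) u v a b : open O -> 0 < r -> cbox p r `<=` O ->
  holomorphic (O `\ p) u v a b ->
  {for p, continuous u} -> {for p, continuous v} -> u p = 0 -> v p = 0 ->
  0 <= m2 ->
  (forall z, cbox p r z -> ~ box p r z -> sqmod u v z <= m2) ->
  forall z, cbox p r z -> sqmod u v z <= m2.
Proof.
move=> oO r0 BO h cup cvp up vp m20 hbd z1 Bz1; rewrite leNgt; apply/negP => hz1.
have oO' := open_remove_point _ p oO.
have cu z : O z -> {for z, continuous u} /\ {for z, continuous v}.
  move=> Oz; have [->//|zp] := eqVneq z p.
  by apply: (holo_continuous (O `\ p) _ _ a b) => //; split => //; exact/eqP.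
pose al := u z1; pose be := v z1; pose s := sqmod u v z1.
have sE : s = al * al + be * be by [].
have hU := holo_mul _ _ _ _ _ _ _ _ _ oO' (holo_cst (O `\ p) al (- be)) h.
set U := (cst al * u - _) in hU.
have UE z : U z = al * u z + be * v z.
  by rewrite /U !fctE /cst /=; ring.
have Ubd z : cbox p r z -> ~ box p r z -> U z <= (s + m2) / 2.
  move=> hz hz'; have h1 := hbd z hz hz'.
  have s0 : 0 < s by apply: le_lt_trans hz1.
  have h2 : U z ^+ 2 <= s * sqmod u v z.
    rewrite UE sE /sqmod !fctE -subr_ge0.
    have -> : (al * al + be * be) * (u z * u z + v z * v z) - (al * u z + be * v z) ^+ 2
       = (al * v z - be * u z) ^+ 2 by ring.
    exact: sqr_ge0.
  have h3 : s * sqmod u v z <= s * m2 by rewrite ler_pM2l.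
  have h4 : s * m2 <= ((s + m2) / 2) ^+ 2.
    have : 0 <= ((s - m2) / 2) ^+ 2 by exact: sqr_ge0.
    have -> : ((s - m2) / 2) ^+ 2 = ((s + m2) / 2) ^+ 2 - s * m2 by field.
    by rewrite subr_ge0.
  have s2 : 0 <= (s + m2) / 2 by lra.
  apply: le_trans (ler_norm _) _.
  rewrite -(@ler_sqr _ `|U z|) ?nnegrE// real_normK ?num_real//.
  exact: le_trans h2 (le_trans h3 h4).
pose gam := (s - m2) / 2.
have gam0 : 0 < gam by rewrite /gam; rewrite -/s in hz1; lra.
pose del := gam / (2 * r ^+ 2).
have r20 : 0 < r ^+ 2 by rewrite exprn_gt0.
have del0 : 0 < del by rewrite /del divr_gt0// mulr_gt0.
have delb z : cbox p r z -> del * (z.1 - p.1) ^+ 2 <= gam / 2.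
  move=> [h1 _]; have h2 : (z.1 - p.1) ^+ 2 <= r ^+ 2.
    by rewrite -real_normK ?num_real// ler_sqr ?nnegrE// ltW.
  have -> : gam / 2 = del * r ^+ 2 by rewrite /del; field; rewrite gt_eqF.
  by rewrite ler_pM2l.
pose G : R * R -> R := U + cst del * ((fst - cst p.1) * (fst - cst p.1)).
have GE z : G z = U z + del * (z.1 - p.1) ^+ 2 by [].
have cG z : O z -> {for z, continuous G}.
  move=> /cu[cuz cvz].
  have cX : {for z, continuous ((fst : R * R -> R) - cst p.1)}.
    by apply: continuousB; [exact: continuous_fst|exact: cst_continuous].
  apply: continuousD.
    by apply: continuousB; apply: continuousM => //; exact: cst_continuous.
  by apply: continuousM; [exact: cst_continuous|exact: continuousM].
have [||m mB Gm] := @compact_EVT_max _ _ G (cbox p r) (ex_intro _ z1 Bz1).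
- exact: compact_cbox.
- by apply: continuous_in_subspaceT => z; rewrite inE => /BO; exact: cG.
rewrite inE in mB.
have low : s <= G m.
  apply: le_trans (Gm z1 _); last by rewrite inE.
  by rewrite GE UE -/al -/be -sE lerDl mulr_ge0 ?(ltW del0)// sqr_ge0.
have dm := delb m mB.
have mb : box p r m.
  apply: contrapT => nb; have := Ubd m mB nb; have := low; rewrite GE.
  by rewrite /gam in dm gam0; lra.
have mp : m <> p.
  move=> mp; have := low; rewrite GE UE mp up vp !mulr0 subrr expr0n /= mulr0.
  by rewrite -/s in hz1; lra.
apply: (@no_local_max R (O `\ p) U _ _ _ m p.1 del oO' hU _ del0).
  by split => //; exact: BO.
apply: filterS (nbhs_box _ _ _ mb) => w /cbox_box hw.
by rewrite -!GE; apply: Gm; rewrite inE.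
Qed.

(** Schwarz lemma for a double zero: apply [weak_max] to [h / (z - p)], where
    [h = u + i v]. Because the derivative of [h] also vanishes at [p], this quotient
    tends to 0 at [p], so no removable singularity theorem is needed. *)
Lemma schwarz O p (r M2 : R) u v a b : open O -> 0 < r -> cbox p r `<=` O ->
  holomorphic O u v a b -> u p = 0 -> v p = 0 -> a p = 0 -> b p = 0 ->
  (forall z, cbox p r z -> sqmod u v z <= M2) ->
  forall z, cbox p r z ->
    sqmod u v z * r ^+ 2 <= M2 * dist2 p z.
Proof.
move=> oO r0 BO h up vp ap bp hM.
have oO' := open_remove_point _ p oO.
have pB : cbox p r p by split; rewrite subrr normr0 ltW.
have M20 : 0 <= M2 := le_trans (sqmod_ge0 _ _ _) (hM p pB).
have [gu [gv [ga [gb [hg guE gvE gsq _]]]]] := holo_divide_center _ p _ _ _ _ oO h.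
have [gup gvp] : gu p = 0 /\ gv p = 0 by rewrite guE gvE up vp !mul0r subr0 addr0 !mul0r.
(* near p the derivative is at most e / 2, hence u and v are at most
   e / 2 * (|x| + |y|) with z - p = x + i y, and the quotient is at most e *)
have key e : 0 < e -> \forall z \near p, `|gu z| <= e /\ `|gv z| <= e.
  move=> e0.
  have e20 : 0 < e / 2 by rewrite divr_gt0.
  have n : \forall w \near p, O w by apply: open_nbhs_nbhs; split => //; exact: BO.
  have := holo_ca _ _ _ _ _ h p (BO _ pB); rewrite /prop_for /continuous_at ap.
  move=> /cvgr0_norm_le/(_ _ e20) na.
  have := holo_cb _ _ _ _ _ h p (BO _ pB); rewrite /prop_for /continuous_at bp.
  move=> /cvgr0_norm_le/(_ _ e20) nb.
  have [t t0 ht] := (nbhs_boxP p _).1 (filterI n (filterI na nb)).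
  apply/nbhs_boxP; exists t => // z hz.
  have [->|/eqP zp] := eqVneq z p; first by rewrite gup gvp normr0 ltW.
  have ha w : box p t w -> `|a w| <= e / 2 by move=> /ht[_ []].
  have hb w : box p t w -> `|b w| <= e / 2 by move=> /ht[_ []].
  have hb' w : box p t w -> `|(- b) w| <= e / 2 by move=> /hb; rewrite fctE normrN.
  have hh : holomorphic (box p t) u v a b by apply: holo_sub h => w /ht[].
  have [ux uy vx vy _ _] := hh.
  have pt : box p t p by split; rewrite subrr normr0.
  have Lu := partials_lipschitz u a (- b) p t (e / 2) ux uy ha hb' z p hz pt.
  have Lv := partials_lipschitz v b a p t (e / 2) vx vy hb ha z p hz pt.
  rewrite up subr0 in Lu; rewrite vp subr0 in Lv.
  set x := z.1 - p.1 in Lu Lv; set y := z.2 - p.2 in Lu Lv.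
  have zq := dist2_gt0 p z zp.
  have sq : e / 2 * (`|x| + `|y|) ^+ 2 <= e * dist2 p z.
    have -> : dist2 p z = `|x| ^+ 2 + `|y| ^+ 2 by rewrite !real_normK ?num_real.
    rewrite -subr_ge0.
    have -> : e * (`|x| ^+ 2 + `|y| ^+ 2) - e / 2 * (`|x| + `|y|) ^+ 2 =
       e / 2 * (`|x| - `|y|) ^+ 2 by field.
    by rewrite mulr_ge0 ?(ltW e20)// sqr_ge0.
  have bd (s1 s2 c d : R) : `|s1| <= e / 2 * (`|x| + `|y|) ->
      `|s2| <= e / 2 * (`|x| + `|y|) -> `|c| = `|x| -> `|d| = `|y| ->
      `|(s1 * c + s2 * d) / dist2 p z| <= e.
    move=> h1 h2 hc hd.
    rewrite normrM normfV (gtr0_norm zq) ler_pdivrMr//.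
    apply: le_trans (ler_normD _ _) _; rewrite !normrM hc hd.
    apply: le_trans sq; rewrite expr2 mulrA [leRHS]mulrDr.
    by apply: lerD; apply: ler_wpM2r.
  split; first by rewrite guE; exact: bd.
  by rewrite gvE -mulrN; apply: bd => //; rewrite normrN.
have cgu : {for p, continuous gu}.
  by apply/cvgrPdist_le => e /key; apply: filterS => z [? _]; rewrite gup sub0r normrN.
have cgv : {for p, continuous gv}.
  by apply/cvgrPdist_le => e /key; apply: filterS => z [_ ?]; rewrite gvp sub0r normrN.
have r20 : 0 < r ^+ 2 by rewrite exprn_gt0.
have W := @weak_max O p r (M2 / r ^+ 2) gu gv _ _ oO r0 BO hg cgu cgv gup gvp.
move=> z Bz.
have [->|/eqP zp] := eqVneq z p.
  by rewrite (sqmod_root _ _ _ up vp) mul0r mulr_ge0// dist2_ge0.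
have zq := dist2_gt0 p z zp.
have := W _ _ z Bz; rewrite gsq// => W'.
rewrite mulrC -ler_pdivlMl// mulrC mulrAC -ler_pdivrMr//.
apply: W'; first by rewrite divr_ge0// ltW.
move=> w Bw nb.
have bw : r ^+ 2 <= dist2 p w.
  have : r <= `|w.1 - p.1| \/ r <= `|w.2 - p.2|.
    have [h1|] := ltP `|w.1 - p.1| r; last by left.
    have [h2|] := ltP `|w.2 - p.2| r; last by right.
    by exfalso; apply: nb.
  have K (t : R) : r <= `|t| -> r ^+ 2 <= t ^+ 2.
    by move=> ht; rewrite -(real_normK (num_real t)) ler_sqr ?nnegrE// ltW.
  move=> [/K h1|/K h1]; apply: le_trans h1 _; rewrite ?lerDl ?lerDr; exact: sqr_ge0.
have wp : w <> p by move=> wp; apply: nb; rewrite wp; split; rewrite subrr normr0.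
rewrite gsq// ler_pdivrMr ?dist2_gt0//.
apply: le_trans (hM w Bw) _.
by rewrite mulrAC ler_pdivlMr// ler_wpM2l.
Qed.
End Schwarz.

(** * Strong maximum principle and unique continuation *)

Section Identity.
Context {R : realType}.
Implicit Types (u v a b f : R * R -> R) (z w p : R * R) (O : set (R * R)).

Lemma box_center p (r : R) : 0 < r -> box p r p.
Proof. by move=> r0; split; rewrite subrr normr0. Qed.

Lemma open_box p (r : R) : open (box p r).
Proof. by rewrite box_ball; exact: ball_open. Qed.

(** The holomorphic estimates involve the Euclidean distance while the domains
    are squares: halving the side brings the Euclidean distance down to
    [r / sqrt 2]. *)
Lemma euclid_half p (r : R) z : cbox p (r / 2) z ->
  2 * dist2 p z <= r ^+ 2.
Proof.
have K (t : R) : `|t| <= r / 2 -> 4 * t ^+ 2 <= r ^+ 2.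
  move=> ht; have h0 := le_trans (normr_ge0 _) ht.
  have : t ^+ 2 <= (r / 2) ^+ 2 by rewrite -(real_normK (num_real t)) ler_sqr ?nnegrE.
  have -> : (r / 2) ^+ 2 = r ^+ 2 / 4 by field.
  by lra.
by move=> [/K h1 /K h2]; rewrite /dist2; lra.
Qed.

(** Strong maximum principle. Let [h = u + i v]. The derivative of [h] vanishes at the
    maximum [p] of [u], and [k = h / (h - 2 e)] has modulus at most 1 for [e > 0]
    because [u <= 0]. The Schwarz lemma bounds [k] by [|z - p| / q]; letting [e] tend
    to 0 gives [|h| <= |h| |z - p| / q], hence [h = 0] where [|z - p| < q]. *)
Lemma strong_max_local O u v a b p : open O -> holomorphic O u v a b -> O p ->
  u p = 0 -> v p = 0 -> (\forall z \near p, u z <= 0) ->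
  \forall z \near p, u z = 0 /\ v z = 0.
Proof.
move=> oO h Op up vp hneg.
have n : \forall w \near p, O w by exact: open_nbhs_nbhs.
have [r r0 hr] := (nbhs_boxP p _).1 (filterI n hneg).
have {}h : holomorphic (box p r) u v a b by apply: holo_sub h => z /hr[].
have pr : box p r p := box_center p r r0.
have nb : nbhs p (box p r) by exact: nbhs_box.
have ap : a p = 0.
  rewrite [p]surjective_pairing.
  apply: (@derive_local_max R (fun x => u (x, p.2)) (fun x => a (x, p.2)) p.1).
    apply: filterS (nbhs_slice1 _ _ nb) => x hx.
    by apply: (is_derive_slice1 _ (x, p.2) _).1; exact: (holo_ux _ _ _ _ _ h).
  by rewrite -surjective_pairing up; exact: (nbhs_slice1 _ _ hneg).
have bp : b p = 0.
  apply/eqP; rewrite -oppr_eq0; apply/eqP.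
  rewrite [p]surjective_pairing.
  apply: (@derive_local_max R (fun y => u (p.1, y)) (fun y => - b (p.1, y)) p.2).
    apply: filterS (nbhs_slice2 _ _ nb) => x hx.
    by apply: (is_derive_slice2 _ (p.1, x) _).1; exact: (holo_uy _ _ _ _ _ h).
  by rewrite -surjective_pairing up; exact: (nbhs_slice2 _ _ hneg).
pose q := r / 2.
have q0 : 0 < q by rewrite /q; lra.
have qB : cbox p q `<=` box p r by apply: box_cbox; rewrite /q; lra.
have key z e : cbox p (q / 2) z -> 0 < e -> sqmod u v z <= 4 * e * (e - u z).
  move=> hz e0.
  have hd := holo_add _ _ _ _ _ _ _ _ _ h (holo_cst (box p r) (- (2 * e)) 0).
  have dE w : sqmod (u + cst (- (2 * e))) (v + cst 0) w = (u w - 2 * e) ^+ 2 + v w ^+ 2.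
    by rewrite /sqmod !fctE addr0.
  have d0 w : box p r w -> 0 < sqmod (u + cst (- (2 * e))) (v + cst 0) w.
    move=> /hr[_ uw]; rewrite dE ltr_wpDr ?sqr_ge0// exprn_even_gt0//=; apply/eqP; lra.
  have [gu [gv [ga [gb [hg guE gvE gsq gab]]]]] := holo_quotient _ _ _ _ _ _ _ _ _
    (open_box p r) (fun w hw => lt0r_neq0 (d0 w hw)) h hd.
  have [gap gbp] := gab p up vp ap bp.
  have gup : gu p = 0 by rewrite guE up vp !mul0r addr0 mul0r.
  have gvp : gv p = 0 by rewrite gvE up vp !mul0r subr0 mul0r.
  have hb w : cbox p q w -> sqmod gu gv w <= 1.
    move=> /qB bw; have dw := d0 w bw.
    rewrite gsq ?lt0r_neq0// ler_pdivrMr// mul1r dE /sqmod !fctE.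
    have [_ uw] := hr w bw.
    have : 0 <= e * (e - u w) by rewrite mulr_ge0//; lra.
    by rewrite !expr2; lra.
  have qz : cbox p q z by move: hz => [h1 h2]; split; lra.
  have := schwarz _ _ _ _ _ _ _ _ (open_box p r) q0 qB hg gup gvp gap gbp hb z qz.
  rewrite mul1r => S.
  have q20 : 0 < q ^+ 2 by rewrite exprn_gt0.
  have S2 : 2 * sqmod gu gv z <= 1.
    rewrite -(ler_pM2r q20) mul1r; have := euclid_half _ _ _ hz; lra.
  have dz := d0 z (qB _ qz).
  rewrite gsq ?lt0r_neq0// mulrA ler_pdivrMr// mul1r dE /sqmod !fctE in S2.
  by rewrite /sqmod !fctE; rewrite !expr2 in S2; lra.
apply/nbhs_boxP; exists (q / 2); first by lra.
move=> z /cbox_box hz.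
have uz : u z <= 0.
  by apply: (hr z _).2; apply: qB; move: hz => [h1 h2]; split; lra.
have S0 : sqmod u v z <= 0.
  (* a value of e for which the bound of key, at most 4 e (1 - u z), is below X *)
  rewrite leNgt; apply/negP => X0.
  set X := sqmod u v z in X0.
  pose e := Num.min 1 (X / (8 * (1 - u z))).
  have c0 : 0 < 8 * (1 - u z) by lra.
  have e0 : 0 < e by rewrite lt_min ltr01 divr_gt0.
  have e1 : e <= 1 by rewrite ge_min lexx.
  have eX : e * (8 * (1 - u z)) <= X by rewrite -ler_pdivlMr// ge_min lexx orbT.
  have := key z e hz e0; rewrite -/X.
  have : 4 * e * (e - u z) <= 4 * e * (1 - u z) by rewrite ler_pM2l; lra.
  by lra.
exact: sqmod_le0.
Qed.

Lemma is_derive_near0 f z (e : R * R) l : (\forall w \near z, f w = 0) ->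
  is_derive z e f l -> l = 0.
Proof.
move=> hn [_ <-].
by rewrite (@near_eq_derive _ _ _ f (cst 0))// derive_cst.
Qed.

Lemma holo_extend0 O p u v a b : open O -> holomorphic (O `\ p) u v a b ->
  (\forall z \near p, [/\ u z = 0, v z = 0, a z = 0 & b z = 0]) ->
  holomorphic O u v a b.
Proof.
move=> oO [ux uy vx vy ca cb] hn.
have D0 f (e : R * R) : (\forall z \near p, f z = 0) -> is_derive p e f 0.
  move=> hf; apply: (@near_eq_is_derive _ _ _ (cst 0) f).
    by apply: filterS hf => z ->.
have C0 f : (\forall z \near p, f z = 0) -> {for p, continuous f}.
  move=> hf; rewrite /prop_for /continuous_at (nbhs_singleton hf).
  apply: (cvg_trans (near_eq_cvg _) (cvg_cst (0 : R))).
  by apply: filterS hf => z ->.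
have [hu hv ha hb] : [/\ \forall z \near p, u z = 0, \forall z \near p, v z = 0,
   \forall z \near p, a z = 0 & \forall z \near p, b z = 0].
  by split; apply: filterS hn => z [].
have [ap bp] := (nbhs_singleton ha, nbhs_singleton hb).
split=> z Oz; have [->|/eqP zp] := eqVneq z p.
- by rewrite ap; exact: D0.
- exact: ux.
- by rewrite bp oppr0; exact: D0.
- exact: uy.
- by rewrite bp; exact: D0.
- exact: vx.
- by rewrite ap; exact: D0.
- exact: vy.
- exact: C0.
- exact: ca.
- exact: C0.
- exact: cb.
Qed.

Lemma near_near z (P : set (R * R)) : nbhs z P -> \forall w \near z, nbhs w P.
Proof.
move=> /nbhs_boxP[r r0 hr]; apply/nbhs_boxP; exists r => // w hw.
by apply: filterS hr _; exact: nbhs_box.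
Qed.

(** If [h = u + i v] vanishes near [p], then so does [h / (z - p)], and the Schwarz lemma
    bounds that quotient by the bound of [h] divided by [r]; so the division can be
    repeated [N] times. *)
Lemma vanishing_order N O p (r M2 : R) u v a b : open O -> 0 < r -> cbox p r `<=` O ->
  holomorphic O u v a b -> (\forall z \near p, u z = 0 /\ v z = 0) ->
  (forall z, cbox p r z -> sqmod u v z <= M2) ->
  forall z, cbox p r z ->
    sqmod u v z <= M2 * (dist2 p z / r ^+ 2) ^+ N.
Proof.
move=> oO r0 BO; elim: N M2 u v a b => [|N IH] M2 u v a b h hn hM.
  by move=> z Bz; rewrite expr0 mulr1; exact: hM.
have pB : cbox p r p by exact/cbox_box/box_center.
have Op := BO _ pB.
have hn4 : \forall z \near p, [/\ u z = 0, v z = 0, a z = 0 & b z = 0].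
  have nO : \forall z \near p, O z by exact: open_nbhs_nbhs.
  apply: filterS (filterI nO (near_near _ _ hn)) => z [Oz nz].
  have [uz vz] := nbhs_singleton nz.
  have hu : \forall w \near z, u w = 0 by apply: filterS nz => w [].
  have hv : \forall w \near z, v w = 0 by apply: filterS nz => w [].
  by split=> //; [apply: is_derive_near0 hu (holo_ux _ _ _ _ _ h _ Oz)
    |apply: is_derive_near0 hv (holo_vx _ _ _ _ _ h _ Oz)].
have [up vp ap bp] := nbhs_singleton hn4.
have [gu [gv [ga [gb [hg guE gvE gsq gab]]]]] := holo_divide_center _ p _ _ _ _ oO h.
have hg0 : \forall z \near p, [/\ gu z = 0, gv z = 0, ga z = 0 & gb z = 0].
  apply: filterS hn4 => z [uz vz az bz]; have [? ?] := gab z uz vz az bz.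
  by rewrite guE gvE uz vz !mul0r subr0 addr0 !mul0r.
have {}hg := holo_extend0 _ _ _ _ _ _ oO hg hg0.
have r20 : 0 < r ^+ 2 by rewrite exprn_gt0.
have M20 : 0 <= M2 := le_trans (sqmod_ge0 _ _ _) (hM p pB).
have S := schwarz _ _ _ _ _ _ _ _ oO r0 BO h up vp ap bp hM.
have gM z : cbox p r z -> sqmod gu gv z <= M2 / r ^+ 2.
  move=> Bz; have [->|/eqP zp] := eqVneq z p.
    have [gup gvp _ _] := nbhs_singleton hg0.
    by rewrite (sqmod_root _ _ _ gup gvp) divr_ge0// ltW.
  have zq := dist2_gt0 p z zp.
  rewrite gsq// ler_pdivrMr// mulrAC ler_pdivlMr//; exact: S.
have hg1 : \forall z \near p, gu z = 0 /\ gv z = 0 by apply: filterS hg0 => z [].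
move=> z Bz; have := IH _ _ _ _ _ hg hg1 gM z Bz.
have [->|/eqP zp] := eqVneq z p.
  move=> _; rewrite (sqmod_root _ _ _ up vp) mulr_ge0// exprn_ge0// divr_ge0 ?(ltW r20)//.
  exact: dist2_ge0.
have zq := dist2_gt0 p z zp.
rewrite gsq// ler_pdivrMr// => /le_trans; apply.
rewrite [X in _ <= _ * X]exprSr; set t := (_ / _) ^+ N.
rewrite le_eqVlt; apply/orP; left; apply/eqP; field.
by rewrite gt_eqF.
Qed.

(** Let [N] tend to infinity in [vanishing_order]. *)
Lemma vanishing_spreads O p (r : R) u v a b : open O -> 0 < r -> cbox p r `<=` O ->
  holomorphic O u v a b -> (\forall z \near p, u z = 0 /\ v z = 0) ->
  forall z, cbox p (r / 2) z -> u z = 0 /\ v z = 0.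
Proof.
move=> oO r0 BO h hn z hz.
have pB : cbox p r p by exact/cbox_box/box_center.
have [||m mB hm] := @compact_EVT_max _ _ (sqmod u v) (cbox p r) (ex_intro _ p pB).
- exact: compact_cbox.
- apply: continuous_in_subspaceT => w; rewrite inE => /BO Ow.
  have [cu cv] := holo_continuous _ _ _ _ _ _ oO h Ow.
  by apply: continuousD; exact: continuousM.
set M2 := sqmod u v m in hm.
have hM w : cbox p r w -> sqmod u v w <= M2 by move=> Bw; apply: hm; rewrite inE.
have Bz : cbox p r z by move: hz => [h1 h2]; split; lra.
apply: sqmod_le0; rewrite leNgt; apply/negP => X0.
have := @upper_nthrootP _ (M2 / sqmod u v z) _ (leqnn _).
set N := Num.bound _ => hN.
have := vanishing_order N _ _ _ _ _ _ _ _ oO r0 BO h hn hM z Bz.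
apply/negP; rewrite -ltNge.
have r20 : 0 < r ^+ 2 by rewrite exprn_gt0.
have h2 : (dist2 p z / r ^+ 2) ^+ N <= (2^-1) ^+ N.
  apply: lerXn2r; rewrite ?nnegrE.
  - by rewrite divr_ge0 ?(ltW r20)// dist2_ge0.
  - by rewrite invr_ge0.
  - by rewrite ler_pdivrMr//; have := euclid_half _ _ _ hz; lra.
apply: le_lt_trans (ler_wpM2l (sqmod_ge0 u v m) h2) _.
by rewrite exprVn ltr_pdivrMr ?exprn_gt0// mulrC -ltr_pdivrMr.
Qed.

(** The interior of the zero set is closed in [D]: a point of its closure lies in
    half of a box around one of its points, and [vanishing_spreads] applies. *)
Lemma identity_theorem D u v a b z0 : open D -> connected D -> holomorphic D u v a b ->
  D z0 -> (\forall z \near z0, u z = 0 /\ v z = 0) ->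
  forall z, D z -> u z = 0 /\ v z = 0.
Proof.
move=> oD cD h Dz0 hz0.
pose Z : set (R * R) := [set z | D z /\ \forall w \near z, u w = 0 /\ v w = 0].
suff <- : Z = D by move=> z [_ /nbhs_singleton].
apply: cD; first by exists z0.
- exists Z; last by apply/seteqP; split=> z; [move=> [? ?]; split|move=> []].
  rewrite openE => z [Dz hz]; have nD : nbhs z D by exact: open_nbhs_nbhs.
  by apply: filterS (filterI (near_near _ _ hz) nD) => w [hw Dw]; split.
- exists (closure Z); first exact: closed_closure.
  apply/seteqP; split=> z; first by move=> hz; split; [case: hz|exact: subset_closure].
  move=> [Dz cz]; split=> //.
  have [r r0 hr] := (nbhs_boxP z _).1 (open_nbhs_nbhs (conj oD Dz)).
  have r40 : 0 < r / 4 by lra.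
  have [p [[Dp hp] zp]] := cz _ (nbhs_box _ _ _ (box_center z (r / 4) r40)).
  have pz : box p (r / 4) z by move: zp => [? ?]; split; rewrite distrC.
  have r20 : 0 < r / 2 by lra.
  have BD : cbox p (r / 2) `<=` D.
    move=> w [w1 w2]; apply: hr; move: zp => [z1 z2]; split.
    - rewrite -(subrKA p.1); apply: le_lt_trans (ler_normD _ _) _; lra.
    - rewrite -(subrKA p.2); apply: le_lt_trans (ler_normD _ _) _; lra.
  apply: filterS (nbhs_box _ _ _ pz) => w bw.
  apply: (vanishing_spreads _ _ _ _ _ _ _ oD r20 BD h hp).
  by move: bw => [? ?]; split; lra.
Qed.

(** After a change of sign [u z0 >= 0], and then [u <= |u| <= u z0] near [z0]. *)
Theorem abs_max_constant D u v a b z0 : open D -> connected D -> holomorphic D u v a b ->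
  D z0 -> (\forall z \near z0, `|u z| <= `|u z0|) ->
  forall z, D z -> u z = u z0 /\ v z = v z0.
Proof.
move=> oD cD h Dz0 hm.
wlog u0 : u v a b h hm / 0 <= u z0.
  move=> H; have [u0|u0] := leP 0 (u z0); first exact: (H u v a b).
  have h' := holo_mul _ _ _ _ _ _ _ _ _ oD (holo_cst D (-1) 0) h.
  set u' := (cst (-1) * u - _) in h'; set v' := (cst (-1) * v + _) in h'.
  have uE z : u' z = - u z by rewrite /u' !fctE; ring.
  have vE z : v' z = - v z by rewrite /v' !fctE; ring.
  have hm' : \forall z \near z0, `|u' z| <= `|u' z0|.
    by apply: filterS hm => w; rewrite !uE !normrN.
  have u0' : 0 <= u' z0 by rewrite uE; lra.
  move=> z Dz; have [e1 e2] := H _ _ _ _ h' hm' u0' z Dz.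
  by split; apply: oppr_inj; rewrite -?uE -?vE.
have h' := holo_add _ _ _ _ _ _ _ _ _ h (holo_cst D (- u z0) (- v z0)).
have hu : \forall z \near z0, (u + cst (- u z0)) z <= 0.
  by apply: filterS hm => w; rewrite fctE (ger0_norm u0) /= subr_le0; apply: le_trans (ler_norm _).
have H0 := strong_max_local _ _ _ _ _ _ oD h' Dz0 (subrr _) (subrr _) hu.
move=> z Dz; have [] := identity_theorem _ _ _ _ _ _ oD cD h' Dz0 H0 z Dz.
by rewrite !fctE => /eqP + /eqP; rewrite !subr_eq0 => /eqP ? /eqP ?.
Qed.

End Identity.

(** * Functionals, coordinates and slices of a Cartan algebra *)

Section Functionals.
Context {R : realType} {V : vectType R}.
Implicit Types (l : V -> R) (F : R * R -> V).

Lemma scalar_sum l n (c : 'I_n -> R) (e : 'I_n -> V) : scalar l ->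
  l (\sum_i c i *: e i) = \sum_i c i * l (e i).
Proof.
move=> hl; have l0 : l 0 = 0.
  by have := hl (-1) 0 0; rewrite scaler0 addr0 mulN1r addNr.
apply: (big_ind2 (fun x y => l x = y)) => //.
- by move=> x1 y1 x2 y2 <- <-; rewrite -[x1]scale1r hl mul1r scale1r.
- by move=> i _; rewrite -[_ *: _]addr0 hl l0 addr0.
Qed.

Lemma scalar_to_rV l (x : V) : scalar l ->
  l x = \sum_j to_rV x 0 j * l (vbasis {:V})`_j.
Proof.
move=> hl; rewrite -{1}(passmx.rVofK (vbasisP fullv) x) /passmx.vecof.
exact: scalar_sum.
Qed.

Lemma scalar_of_rV l (M : 'rV[R]_(\dim {:V})) : scalar l ->
  l (of_rV M) = \sum_j M 0 j * l (vbasis {:V})`_j.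
Proof. by move=> hl; rewrite /of_rV /passmx.vecof scalar_sum. Qed.

(** Real linear functionals carry the coordinatewise calculus of a finite
    dimensional space over to real functions. *)
Lemma scalar_is_derive l F z (e : R * R) : scalar l -> derivable (to_rV \o F) z e ->
  is_derive z e (fun w => l (F w)) (l (partial e F z)).
Proof.
move=> hl dF.
have -> : (fun w => l (F w)) =
    \sum_j (fun w => (to_rV \o F) w 0 j * l (vbasis {:V})`_j).
  by apply/funext => w; rewrite scalar_to_rV// fct_sumE.
rewrite /partial scalar_of_rV//.
apply: is_derive_sum => j.
have dj := (derivable_mxP _ _ _).1 dF 0 j.
apply: is_derive_eq (is_deriveM (derivableP dj) (is_derive_cst (l (vbasis {:V})`_j) z e)) _.
rewrite scaler0 add0r derive_mx// mxE /GRing.scale /=; exact: mulrC.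
Qed.

Lemma scalar_continuous l F (z : R * R) : scalar l -> {for z, continuous (to_rV \o F)} ->
  {for z, continuous (fun w => l (F w))}.
Proof.
move=> hl cF.
have -> : (fun w => l (F w)) =
    \sum_j (fun w => (to_rV \o F) w 0 j * l (vbasis {:V})`_j).
  by apply/funext => w; rewrite scalar_to_rV// fct_sumE.
elim/big_ind: _ => [|f g cf cg|j _]; first exact: cst_continuous.
  exact: continuousD.
apply: (@continuousM _ _ (fun w => (to_rV \o F) w 0 j) (cst _)); last exact: cst_continuous.
apply: (@cvg_comp _ _ _ (to_rV \o F) (fun M : 'rV[R]_(\dim {:V}) => M 0 j)); first exact: cF.
exact: coord_continuous.
Qed.

End Functionals.

Section Algebra.
Context {R : realType} {n : nat} (A : cartanStarAlgebra R n).
Implicit Types (L M N K H : {set 'I_n}) (x y J : A).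

(** Composing a holomorphic map into the complexification of [A] with a real
    functional [l] gives the real part of a holomorphic function, whose imaginary
    part is [- l] of [iota] times the map: [w |-> l w - i l (iota w)] is complex
    linear. *)
Lemma holo_functional (l : A * A -> R) D (F : R * R -> A * A) : scalar l ->
  C1_on D F -> (forall z, D z -> partial (1, 0) F z + iota_mul (partial (0, 1) F z) = 0) ->
  holomorphic D (fun z => l (F z)) (fun z => - l (iota_mul (F z)))
    (fun z => l (partial (1, 0) F z)) (fun z => - l (iota_mul (partial (1, 0) F z))).
Proof.
move=> hl hF hCR.
pose l' w := - l (iota_mul w).
have hl' : scalar l'.
  move=> a x y; rewrite /l' /iota_mul /=.
  have -> : (- (a *: x + y).2, (a *: x + y).1) = a *: (- x.2, x.1) + (- y.2, y.1).
    by transitivity (a *: - x.2 - y.2, a *: x.1 + y.1); rewrite //= scalerN opprD.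
  by rewrite hl opprD mulrN.
have iotaK (w : A * A) : iota_mul (iota_mul w) = - w by case: w => w1 w2.
have CR z : D z -> iota_mul (partial (1, 0) F z) = partial (0, 1) F z.
  move=> Dz; have /eqP := hCR z Dz; rewrite addr_eq0 => /eqP ->.
  by transitivity (- iota_mul (iota_mul (partial (0, 1) F z))); last rewrite iotaK opprK.
have lN (w : A * A) : l (- w) = - l w.
  have l0 : l 0 = 0 by have := hl (-1) 0 0; rewrite scaler0 addr0 mulN1r addNr.
  by rewrite -scaleN1r -[_ *: _]addr0 hl l0 addr0 mulN1r.
have dx z : D z -> derivable (to_rV \o F) z (1, 0) by move=> /(hF _ (or_introl erefl))[].
have dy z : D z -> derivable (to_rV \o F) z (0, 1) by move=> /(hF _ (or_intror erefl))[].
have cx z : D z -> {for z, continuous (to_rV \o partial (1, 0) F)}.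
  by move=> /(hF _ (or_introl erefl))[].
split=> z Dz.
- exact: scalar_is_derive (dx z Dz).
- by rewrite opprK CR//; exact: scalar_is_derive (dy z Dz).
- exact: (@scalar_is_derive _ _ l' F z (1, 0) hl' (dx z Dz)).
- apply: is_derive_eq (@scalar_is_derive _ _ l' F z (0, 1) hl' (dy z Dz)) _.
  by rewrite /l' -CR// iotaK lN opprK.
- exact: scalar_continuous (cx z Dz).
- exact: (@scalar_continuous _ _ l' (partial (1, 0) F) z hl' (cx z Dz)).
Qed.

Lemma ccoord_scalar K : scalar (@ccoord R n A K).
Proof. by move=> a x y; rewrite /ccoord linearP. Qed.

Lemma codom_cbas K : (codom_tuple (cbas A))`_(enum_rank K) = cbas A K.
Proof. by rewrite nth_codom enum_rankK. Qed.

Lemma ccoord_cbas L K : ccoord L (cbas A K) = (K == L)%:R.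
Proof.
rewrite /ccoord -(codom_cbas K) coord_free ?(inj_eq enum_rank_inj)//.
exact: basis_free (cbas_basis A).
Qed.

Lemma ccoord_sum x : x = \sum_K ccoord K x *: cbas A K.
Proof.
rewrite {1}(coord_basis (cbas_basis A) (memvf x)).
rewrite [RHS](reindex (fun i : 'I_#|{set 'I_n}| => enum_val i)) /=; last first.
  by apply: onW_bij; exact: enum_val_bij.
by apply: eq_bigr => i _; rewrite nth_codom /ccoord enum_valK.
Qed.

Lemma ccoord_eq x y : (forall K, ccoord K x = ccoord K y) -> x = y.
Proof.
by move=> h; rewrite (ccoord_sum x) (ccoord_sum y); apply: eq_bigr => K _; rewrite h.
Qed.

Lemma scalar_eq (l l' : A -> R) : scalar l -> scalar l' ->
  (forall K, l (cbas A K) = l' (cbas A K)) -> forall x, l x = l' x.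
Proof.
move=> hl hl' h x; rewrite (ccoord_sum x).
rewrite (reindex (fun i : 'I_#|{set 'I_n}| => enum_val i)) /=; last first.
  by apply: onW_bij; exact: enum_val_bij.
by rewrite !scalar_sum//; apply: eq_bigr => K _; rewrite h.
Qed.

Lemma symdiff_eq L M K : (symdiff (symdiff L M) K == L) = (K == M).
Proof.
apply/eqP/eqP => [/setP h|->].
  apply/setP => i; have := h i; rewrite !inE.
  by case: (i \in L); case: (i \in M); case: (i \in K).
by apply/setP => i; rewrite !inE; case: (i \in L); case: (i \in M).
Qed.

(** [e_M] is the only basis vector sent to a multiple of [e_L], because [K] is
    determined by its symmetric difference with a given set. This is why a Cartan
    pair controls the component [f_M] together with [f_L]. *)
Lemma ccoord_mul L M y :
  ccoord L (cmul (cbas A (symdiff L M)) y) = csgn A (symdiff L M) M * ccoord M y.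
Proof.
move: y; apply: scalar_eq.
- by move=> a x y; rewrite cmul_linearr ccoord_scalar.
- by move=> a x y; rewrite ccoord_scalar mulrDr mulrCA.
- move=> K; rewrite cmul_bas -[_ *: _]addr0 ccoord_scalar.
  rewrite !ccoord_cbas symdiff_eq.
  have -> : ccoord L (0 : A) = 0 by rewrite /ccoord linear0.
  by rewrite addr0; have [->|] := eqVneq K M; rewrite ?mulr0.
Qed.

Lemma cunit_neq0 : cunit A != 0.
Proof.
apply/eqP => h; have := ccoord_cbas finset.set0 finset.set0.
rewrite -/(cunit A) h /ccoord linear0 eqxx => /eqP.
by rewrite eq_sym oner_eq0.
Qed.

Lemma cmulZ (a b : R) x y : cmul (a *: x) (b *: y) = (a * b) *: cmul x y.
Proof.
have c0r (u : A) : cmul u 0 = 0.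
  by have := cmul_linearr u (-1) 0 0; rewrite scaler0 addr0 scaleN1r addNr.
have c0l (u : A) : cmul 0 u = 0.
  by have := cmul_linearl u (-1) 0 0; rewrite /= scaler0 addr0 scaleN1r addNr.
rewrite -[b *: y]addr0 cmul_linearr c0r addr0.
have := cmul_linearl y a x 0; rewrite /= addr0 c0l addr0 => ->.
by rewrite scalerA mulrC.
Qed.

Lemma cmul0r x : cmul x (0 : A) = 0.
Proof. by have := cmul_linearr x (-1) 0 0; rewrite scaler0 addr0 scaleN1r addNr. Qed.

Lemma cconjZ (a : R) x : cconj (a *: x) = a *: cconj x.
Proof.
have c0 : cconj (0 : A) = 0.
  by have := @cconj_linear _ _ A (-1) 0 0; rewrite scaler0 addr0 scaleN1r addNr.
by rewrite -[a *: x]addr0 cconj_linear c0 addr0.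
Qed.

Lemma pair_imag L M : cartan_pair A L M -> imag_units A (cbas A (symdiff L M)).
Proof.
rewrite /cartan_pair /imag_units /= cmul_bas.
rewrite cconjZ cmulZ; set J := cbas A _; set s := csgn A L M => -[h1 h2].
have ss : s * s = 1 by rewrite /s; have [->|->] := csgn_pm1 A L M; rewrite ?mulr1 ?mulrNN ?mulr1.
split; last by rewrite -h2 ss scale1r.
by rewrite -[LHS]scale1r -ss -scalerA h1 scalerN scalerA ss scale1r.
Qed.

(** Conjugation separates the real part, and squaring then determines the
    imaginary part up to sign. *)
Lemma slice_point_eq J J' (a b a' b' : R) : imag_units A J -> imag_units A J' ->
  slice_point J a b = slice_point J' a' b' -> a = a' /\ (b = b' \/ b = - b').
Proof.
move=> [cJ J2] [cJ' J2'] e.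
have u0 := cunit_neq0.
have e' : slice_point J a (- b) = slice_point J' a' (- b').
  have := congr1 (@cconj _ _ A) e; rewrite /slice_point.
  by rewrite !cconj_linear !cconjZ cJ cJ' -[cunit _]scale1r cconj_real !scale1r !scalerN !scaleNr.
have ea : a = a'.
  have : slice_point J a b + slice_point J a (- b) =
      slice_point J' a' b' + slice_point J' a' (- b').
    by rewrite e e'.
  rewrite /slice_point !scaleNr [LHS]addrACA [RHS]addrACA !subrr !addr0 -!scalerDl => /eqP.
  by rewrite -subr_eq0 -scalerBl scaler_eq0 (negPf u0) orbF => /eqP; lra.
split=> //.
have eb : b *: J = b' *: J'.
  by move: e; rewrite /slice_point ea => /addrI.
have : cmul (b *: J) (b *: J) = cmul (b' *: J') (b' *: J') by rewrite eb.
rewrite !cmulZ J2 J2' => /eqP; rewrite -subr_eq0 -scalerBl scaler_eq0 oppr_eq0 (negPf u0) orbF.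
rewrite -!expr2 subr_sqr mulf_eq0 subr_eq0 addr_eq0 => /orP[/eqP ->|/eqP ->]; [by left|by right].
Qed.

Lemma slice_point_continuous J :
  continuous ((fun z => slice_point J z.1 z.2) : R * R -> initial_topology (@to_rV R A)).
Proof.
apply: continuous_comp_initial => z.
have -> : @to_rV R A \o (fun z : R * R => slice_point J z.1 z.2) =
    (fun z : R * R => z.1 *: to_rV (cunit A) + z.2 *: to_rV J).
  apply/funext => w /=; have hl := passmx.rVof_linear (vbasis {:A}).
  have l0 : to_rV (0 : A) = 0.
    by have := hl (-1) 0 0; rewrite scaler0 addr0 scaleN1r addNr.
  by rewrite /slice_point /to_rV hl -[w.2 *: J]addr0 hl -/(to_rV 0) l0 addr0.
apply: cvgD; apply: cvgZr_tmp; [exact: cvg_fst|exact: cvg_snd].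
Qed.

End Algebra.

Theorem theorem5p14 (R : realType) (n : nat) (hn : (0 < n)%N)
    (A : cartanStarAlgebra R n) (halt : alternative A)
    (hS : imag_units A !=set0)
    (D : set (R * R)) (hD : slice_domain D)
    (f : A -> A) (hf : slice_regular D f)
    (C : set (A * A)) (hC : SCP C)
    (hmax : forall L M : {set 'I_n}, C (cbas A L, cbas A M) ->
      exists x : A,
        [/\ circular_set A D x,
            slice_plane (cbas A (symdiff L M)) x &
            local_max_on (circular_set A D)
              (fun y => `|ccoord L (f y)|) x]) :
  exists c : A, forall x, circular_set A D x -> f x = c.
Proof.
have [_ oD cD conD [a0 Da0]] := hD.
have [F [stem ind C1 CR]] := hf.
have [hC1 hC2 _] := hC.
have key L M : C (cbas A L, cbas A M) -> exists c d : R,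
  forall z, D z -> [/\ ccoord L (F z).1 = c, ccoord M (F z).1 = d,
                      ccoord L (F z).2 = 0 & ccoord M (F z).2 = 0].
  move=> CLM.
  have [L' [M' [[eL eM] +]]] := hC1 _ CLM.
  rewrite /cartan_pair -eL -eM => hpair.
  have hJ := pair_imag A L M hpair.
  set J := cbas A (symdiff L M) in hJ.
  have [x [[a' [b' [J' [Dab' hJ' ex']]]] [a [b ex]] hloc]] := hmax L M CLM.
  (* the maximum lies in the slice of J, but circularity may present it in another
     slice; conjugation invariance of D makes the choice harmless *)
  have Dab : D (a, b).
    have [ea eb] := slice_point_eq A J J' a b a' b' hJ hJ' (etrans (esym ex) ex').
    by case: eb => ->; rewrite ea//; exact: (cD _ Dab').
  pose l (w : A * A) := ccoord L (w.1 + cmul J w.2).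
  have hl : scalar l.
    move=> c w w'; rewrite /l /= cmul_linearr -ccoord_scalar; congr ccoord.
    by rewrite scalerDr addrACA.
  have hh := holo_functional A l D F hl C1 CR.
  have hm : \forall z \near (a, b), `|l (F z)| <= `|l (F (a, b))|.
    have nD : \forall z \near (a, b), D z by exact: open_nbhs_nbhs.
    have fl z : D z -> ccoord L (f (slice_point J z.1 z.2)) = l (F z).
      by case: z => z1 z2 Dz; rewrite /l ind.
    move: hloc; rewrite /local_max_on ex => hloc.
    have := @slice_point_continuous R n A J (a, b) _ hloc.
    move=> hloc'; apply: filterS (filterI nD hloc') => z [Dz /= hz].
    rewrite -!fl//; apply: hz; exists z.1, z.2, J; split=> //.
    by rewrite -surjective_pairing.
  have const := abs_max_constant _ _ _ _ _ _ oD conD hh Dab hm.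
  set s := csgn A (symdiff L M) M.
  have s0 : s != 0.
    by rewrite /s; have [->|->] := csgn_pm1 A (symdiff L M) M; rewrite ?oppr_eq0 oner_neq0.
  have cD' (x' y' : A) : ccoord L (x' + y') = ccoord L x' + ccoord L y'.
    by rewrite /ccoord linearD.
  have cN K (x' : A) : ccoord K (- x') = - ccoord K x' by rewrite /ccoord linearN.
  (* E1 and E2, compared at z and at its conjugate, separate the four coordinates *)
  have E1 z : D z -> ccoord L (F z).1 + s * ccoord M (F z).2 = l (F (a, b)).
    by move=> /const[<- _]; rewrite /l cD' ccoord_mul.
  have E2 z : D z -> ccoord L (F z).2 - s * ccoord M (F z).1 = - l (iota_mul (F (a, b))).
    by move=> /const[_ <-]; rewrite /l cD' ccoord_mul /= cN opprD opprK.
  exists (l (F (a, b))), (l (iota_mul (F (a, b))) / s) => z Dz.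
  have [b1 b2] := stem z Dz.
  have := E1 z Dz; have := E1 _ (cD _ Dz); rewrite b1 b2 cN mulrN => e1 e1'.
  have := E2 z Dz; have := E2 _ (cD _ Dz); rewrite b1 b2 cN => e2 e2'.
  have sM : s * ccoord M (F z).2 = 0 by lra.
  split; [lra| |lra|].
  - by apply: (mulfI s0); rewrite mulrCA mulfV// mulr1; lra.
  - by apply: (mulfI s0); rewrite mulr0.
have coords K : exists c, forall z, D z -> ccoord K (F z).1 = c /\ ccoord K (F z).2 = 0.
  have : (fst_indices C `|` snd_indices C) K by rewrite hC2.
  move=> [[M /key[c [d h]]]|[L /key[c [d h]]]]; [exists c|exists d] => z /h[] //.
exists (F (a0, 0)).1 => x [a [b [J [Dab hJ ->]]]].
rewrite ind//.
have -> : (F (a, b)).2 = 0.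
  by apply: ccoord_eq => K; have [c h] := coords K; rewrite (h _ Dab).2 /ccoord linear0.
rewrite cmul0r addr0; apply: ccoord_eq => K; have [c h] := coords K.
by rewrite (h _ Dab).1 (h _ Da0).1.
Qed.
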